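(* Let $\eta\in\{132,213,231,312\}$. For $k\ge2$ define $\tau^*(\eta)\in S_k^{\text{av}(\eta)}$ by $\tau^*(\eta)=k\cdots1$ if $\eta=231$ or $312$, and $\tau^*(\eta)=1\cdots k$ if $\eta=132$ or $213$. In the statements below, $k\ge2$ is a fixed integer, while $(k_n)$ denotes a sequence of integers with $2\le k_n\le n$. (i) For fixed $k$ and $\tau\in S_k^{\text{av}(\eta)}$ with $\tau\ne\tau^*(\eta)$, $$\lim_{n\to\infty}\frac1nE_n^{\text{av}(\eta)}N_n^{(k;\tau)}=\frac1{2\cdot4^{k-1}};$$ and if $k_n=o(n)$ and $\tau=\tau_n\in S_{k_n}^{\text{av}(\eta)}$ with $\tau\neq\tau^*(\eta)$, then $$E_n^{\text{av}(\eta)}N_n^{(k_n;\tau)}\sim\frac n{2\cdot4^{k_n-1}}\quad\text{as } n\to\infty.$$ (ii) For $\tau=\tau^*(\eta)$, $$\lim_{n\to\infty}\frac1nE_n^{\text{av}(\eta)}N_n^{(k;\tau)}=\frac1{4^{k-1}};\qquad E_n^{\text{av}(\eta)}N_n^{(k_n;\tau)}\sim\frac n{4^{k_n-1}}\ \text{ as } n\to\infty,\ \text{if } k_n=o(n)$$ (where in the second relation $\tau=\tau^*(\eta)\in S_{k_n}^{\text{av}(\eta)}$). (iii) $$\lim_{n\to\infty}\frac1nE_n^{\text{av}(\eta)}N_n^{(k)}=\frac{C_k+1}{2\cdot4^{k-1}};\qquad E_n^{\text{av}(\eta)}N_n^{(k_n)}\sim\frac2{\sqrt\pi}\frac n{k_n^{3/2}}\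 \text{ as } n\to\infty,\ \text{if } \lim_{n\to\infty}k_n=\infty\ \text{and } k_n=o(n).$$
   Context: $S_n$ is the set of permutations $\sigma=\sigma_1\cdots\sigma_n$ of $[n]=\{1,\dots,n\}$. A permutation $\sigma\in S_n$ contains $\eta\in S_m$ ($m\le n$) as a pattern if there are indices $1\le i_1<\cdots<i_m\le n$ such that for all $1\le j,k\le m$, $\sigma_{i_j}<\sigma_{i_k}$ if and only if $\eta_j<\eta_k$; otherwise $\sigma$ avoids $\eta$. $S_n^{\text{av}(\eta)}$ is the set of $\sigma\in S_n$ avoiding $\eta$ (and $S_n^{\text{av}(\eta)}=S_n$ if $n<m$). $P_n^{\text{av}(\eta)}$ is the uniform probability measure on $S_n^{\text{av}(\eta)}$ and $E_n^{\text{av}(\eta)}$ is the corresponding expectation. For $2\le k\le n$, $\tau\in S_k^{\text{av}(\eta)}$ and $\sigma\in S_n^{\text{av}(\eta)}$, $N_n^{(k;\tau)}(\sigma)$ is the number of pairs $(l,m)$ with $1\le l,m\le n-k+1$ such that $\{l,l+1,\dots,l+k-1\}=\{\sigma_m,\dots,\sigma_{m+k-1}\}$ and $\tau_i=\sigma_{m+i-1}-(l-1)$ for $i=1,\dots,k$. Further, $N_n^{(k)}(\sigma)=\sum_{\tau\in S_k^{\text{av}(\eta)}}N_n^{(k;\tau)}(\sigma)$. $C_n=\frac1{n+1}\binom{2n}{n}$ is the $n$th Catalan number. $a_n\sim b_n$ means $a_n/b_n\to1$. *)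

(* Defs.v *)
From mathcomp Require Import all_boot all_order all_algebra all_fingroup.
From mathcomp Require Import all_classical all_reals all_analysis.

Set Implicit Arguments.
Unset Strict Implicit.
Unset Printing Implicit Defensive.

Import Order.TTheory GRing.Theory Num.Theory.
Import numFieldNormedType.Exports.

(* 'S_n permutes {0, ..., n-1}: positions and values are shifted down by one
   with respect to permutations of [n] = {1, ..., n}. [oneline] restores the
   usual 1-based one-line notation sigma_1 ... sigma_n. *)
Definition oneline (n : nat) (sigma : 'S_n) : seq nat :=
  [seq (nat_of_ord (sigma i)).+1 | i <- enum 'I_n].

(* [f] lists the occurrence i_1 < ... < i_m; there is none when n < m. *)
Definition contains_pattern (m n : nat) (eta : 'S_m) (sigma : 'S_n) : bool :=
  [exists f : {ffun 'I_m -> 'I_n},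
    [forall j : 'I_m, forall k : 'I_m, (j < k)%N ==> (f j < f k)%N] &&
    [forall j : 'I_m, forall k : 'I_m,
       (sigma (f j) < sigma (f k))%N == (eta j < eta k)%N]].

Definition av (m : nat) (eta : 'S_m) (n : nat) : {set 'S_n} :=
  [set sigma : 'S_n | ~~ contains_pattern eta sigma]%SET.

Section Counting.
Local Open Scope nat_scope.

(* With 0-based l and m, the block of values is {l, ..., l+k-1} and the block of
   positions is {m, ..., m+k-1}. The index type 'I_(n.+1 - k) is {0, ..., n-k}
   when k <= n, and is empty when k > n. *)
Definition clusters (k n : nat) (tau : 'S_k) (sigma : 'S_n) : nat :=
  #|[set lm : 'I_(n.+1 - k) * 'I_(n.+1 - k) |
      ([set v : 'I_n | lm.1 <= v < lm.1 + k]
         == [set sigma j | j in [set j : 'I_n | lm.2 <= j < lm.2 + k]]) &&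
      [forall i : 'I_k, forall j : 'I_n,
         (nat_of_ord j == lm.2 + i) ==> (nat_of_ord (sigma j) == lm.1 + tau i)]
    ]%SET|.

Definition clusters_all (m : nat) (eta : 'S_m) (k n : nat) (sigma : 'S_n) : nat :=
  \sum_(tau in av eta k) clusters tau sigma.

End Counting.

(* [rev_ord] is k ... 1, and the identity is 1 ... k. *)
Definition tau_star (eta : 'S_3) (k : nat) : 'S_k :=
  if oneline eta \in [:: [:: 2; 3; 1]; [:: 3; 1; 2]]
  then perm (@rev_ord_inj k) else 1%g.

Lemma tau_star_av (eta : 'S_3) (k : nat) :
  oneline eta \in [:: [:: 1; 3; 2]; [:: 2; 1; 3]; [:: 2; 3; 1]; [:: 3; 1; 2]] ->
  tau_star eta k \in av eta k.
Proof.
pose o1 : 'I_3 := lift ord0 ord0; pose o2 : 'I_3 := lift ord0 (lift ord0 ord0).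
have Eo : oneline eta =
    [:: (nat_of_ord (eta ord0)).+1; (nat_of_ord (eta o1)).+1;
        (nat_of_ord (eta o2)).+1].
  by rewrite /oneline !enum_ordSl (size0nil (size_enum_ord 0)).
move=> eta_in; rewrite inE; apply/negP => /existsP[f /andP[f_incr f_ord]].
have fltP (i j : 'I_3) : (i < j)%N -> (f i < f j)%N.
  by move/forallP/(_ i)/forallP/(_ j)/implyP: f_incr.
have fordP i j : (tau_star eta k (f i) < tau_star eta k (f j))%N
    = (eta i < eta j)%N.
  by move/forallP/(_ i)/forallP/(_ j)/eqP: f_ord.
have f01 := fltP ord0 o1 isT; have f12 := fltP o1 o2 isT.
have := fordP ord0 o1; have := fordP o1 o2; rewrite /tau_star.
move: eta_in; rewrite Eo !inE !eqseq_cons !eqSS.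
have rev_lt (i j : 'I_k) : (i < j)%N -> (rev_ord i < rev_ord j)%N = false.
  by move=> ij; rewrite ltnNge leq_sub2l // ltnS ltnW.
by case/or4P => /and4P[/eqP-> /eqP-> /eqP-> _] /=;
  rewrite ?perm1 ?permE ?rev_lt ?f01 ?f12.
Qed.

Local Open Scope ring_scope.

Definition unif_prob (R : realType) (T : finType) (A : {set T}) (x : T) : R :=
  if x \in A then #|A|%:R^-1 else 0.

Definition av_expect (R : realType) (m : nat) (eta : 'S_m) (n : nat)
    (X : 'S_n -> nat) : R :=
  \sum_(sigma : 'S_n) unif_prob R (av eta n) sigma * (X sigma)%:R.

Definition catalan (R : realType) (n : nat) : R :=
  (n.+1)%:R^-1 * 'C(2 * n, n)%:R.

Local Open Scope classical_set_scope.

Definition asymp (R : realType) (a b : nat -> R) : Prop :=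
  a n / b n @[n --> \oo] --> (1 : R).

(* The index n starts at 2, the constraint being void for smaller n. *)
Definition cluster_sizes (k : nat -> nat) : Prop :=
  forall n, (2 <= n)%N -> (2 <= k n <= n)%N.

Definition sublinear (R : realType) (k : nat -> nat) : Prop :=
  (fun n => (k n)%:R : R) =o_\oo (fun n => n%:R : R).

(* Main.v *)
Require Import Defs.
From mathcomp Require Import all_boot all_order all_algebra all_fingroup.
From mathcomp Require Import all_classical all_reals all_analysis.
From mathcomp Require Import zify ring lra.
Set Implicit Arguments.
Unset Strict Implicit.
Unset Printing Implicit Defensive.

(** Reversal and complement permute the four patterns 132, 213, 231, 312, carry
    clusters to clusters and carry [tau_star] to [tau_star], so only 231 has to
    be counted.

    A cluster of sigma with pattern tau at positions m, ..., m+k-1 and values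
    l, ..., l+k-1 can be collapsed to one point, which leaves a permutation of
    size N = n-k+1 with a marked point; conversely the marked point of a
    permutation pi of size N can be inflated by tau.  When pi and tau avoid 231,
    the only way in which the inflation can contain 231 is that two points of
    the block play the roles of 2 and 3 and a point outside plays the role of
    1.  This needs an ascent in tau and an entry of pi lower than the marked one
    and to its right.  Hence, if C_N counts the 231-avoiders of size N, the total
    number of clusters over all 231-avoiders of size n is
      - N C_N, the number of all marked permutations, if tau = k ... 1;
      - the total number of right-to-left minima of the 231-avoiders of size N
        for any other tau
    ([count_inflate], [total_clusters_231]).

    Cutting a 231-avoider at its maximum gives an arbitrary pair of
    231-avoiders, the left one entirely below the right one
    ([sum_av_words_max]).  From this follow the Catalan recursion, its closed
    form, and the value (N+1) C_N / 2 of the total number of right-to-left minima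
    ([num_av_catalan], [total_rl_minima_eq]).

    The expectations are therefore N C_N / C_n and (N+1) C_N / (2 C_n), and for
    k = o(n) the asymptotics reduce to 4^(k-1) C_N / C_n --> 1.  This holds since
    C_(m+1) = (4 - 6/(m+2)) C_m and only o(n) consecutive factors, each
    4 (1 - O(1/n)), are involved ([cvg_catalan_ratio]).  For the sum over all tau
    with k --> oo one needs moreover C_k ~ 4^k / (sqrt pi k^(3/2)), which is the
    Wallis product ([central_bounds], [catalan_scaled_cvg]). *)

Section Combinatorics.
Local Open Scope nat_scope.

(** * 231-avoiding words and their decomposition at the maximum *)

Fixpoint av231 (w : seq nat) : bool :=
  if w is x :: w' then av231 w' && pairwise (fun y z => ~~ (z < x < y)) w'
  else true.

Fixpoint rl_minima (w : seq nat) : nat :=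
  if w is x :: w' then all (ltn x) w' + rl_minima w' else 0.

Definition perm_word (n : nat) (w : seq nat) : bool :=
  [&& size w == n, uniq w & all (gtn n) w].

Lemma pairwise_in2W (r : rel nat) (s : seq nat) :
  {in s &, forall x y, r x y} -> pairwise r s.
Proof.
elim: s => [|x s IH] //= rs; rewrite IH ?andbT => [|y z ys zs].
  by apply/allP => y ys; apply: rs; rewrite inE ?eqxx ?ys ?orbT.
by apply: rs; rewrite inE ?ys ?zs orbT.
Qed.

(** The maximum can only play the role of 3, so it forbids exactly the pairs
    (2, 1) with 2 on its left and 1 on its right. *)
Lemma av231_cat_max (A B : seq nat) (m : nat) : all (gtn m) (A ++ B) ->
  av231 (A ++ m :: B) = [&& av231 A, av231 B & allrel leq A B].
Proof.
elim: A => [|a A IH] /=.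
  move=> mB; rewrite allrel0l; congr andb; apply: pairwise_in2W => y z.
  by move=> /(allP mB) /=; lia.
case/andP=> am /[dup] mAB /IH ->; rewrite allrel_consl.
have [aB|aB] /= := boolP (all (leq a) B); rewrite ?andbF ?andbT.
  have -> : pairwise (fun y z => ~~ (z < a < y)) (A ++ m :: B)
     = pairwise (fun y z => ~~ (z < a < y)) A; last first.
    by rewrite -!andbA; do !bool_congr.
  have E y z : z \in m :: B -> ~~ (z < a < y).
    rewrite inE => /orP[/eqP ->|/(allP aB)]; lia.
  rewrite pairwise_cat (pairwise_in2W (s := m :: B)) => [|y z _]; last exact: E.
  by rewrite andbT andb_idl // => _; apply/allrelP => y z _; apply: E.
apply/negbTE; rewrite negb_and; apply/orP; right.
apply: contra aB; rewrite pairwise_cat /= => /and4P[_ _ + _].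
move=> /allP H; apply/allP => z /H /=; move: am => /=; lia.
Qed.

(** Every right-to-left minimum of A remains one because A lies below B; the
    maximum itself is one only when nothing follows it. *)
Lemma rl_minima_cat_max (A B : seq nat) (m : nat) :
  all (gtn m) (A ++ B) -> allrel ltn A B ->
  rl_minima (A ++ m :: B) = rl_minima A + (B == [::]) + rl_minima B.
Proof.
elim: A => [|a A IH] /=.
  case: B => [|b B] //= /andP[bm _] _.
  by have -> : (m < b) = false by lia.
rewrite allrel_consl => /andP[am mAB] /andP[aB AB].
by rewrite IH // all_cat /= aB am /= andbT !addnA.
Qed.

Lemma av231_map (f : nat -> nat) (w : seq nat) :
  {in w &, {mono f : x y / x < y}} -> av231 (map f w) = av231 w.
Proof.
elim: w => [|x w IH] //= fw; rewrite IH => [|y z yw zw]; last first.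
  by apply: fw; rewrite inE ?yw ?zw orbT.
congr andb; rewrite pairwise_map.
apply: (@eq_in_pairwise _ (mem w)) (allss w) => y z yw zw /=.
by rewrite !fw // inE ?yw ?zw ?eqxx ?orbT.
Qed.

Lemma rl_minima_map (f : nat -> nat) (w : seq nat) :
  {in w &, {mono f : x y / x < y}} -> rl_minima (map f w) = rl_minima w.
Proof.
elim: w => [|x w IH] //= fw; rewrite IH => [|y z yw zw]; last first.
  by apply: fw; rewrite inE ?yw ?zw orbT.
congr (nat_of_bool _ + _); rewrite all_map; apply: eq_in_all => y yw /=.
by rewrite fw // inE ?yw ?eqxx ?orbT.
Qed.

(** The two sides of the maximum occupy the values 0, ..., i-1 and i, ..., i+j-1:
    as A lies below B, an entry b of B exceeds the i distinct entries of A, and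
    an entry a of A has the j distinct entries of B between it and the
    maximum. *)
Lemma perm_word_cat_max (i j : nat) (A B : seq nat) :
  size A = i -> size B = j ->
  perm_word (i + j).+1 (A ++ i + j :: B) && av231 (A ++ i + j :: B) =
  [&& perm_word i A, av231 A, all (leq i) B,
     perm_word j (map (subn^~ i) B) & av231 (map (subn^~ i) B)].
Proof.
move=> sA sB; apply/idP/idP; last first.
  case/and5P=> /and3P[_ uA lA] avA lB /and3P[_ uB gB] avB.
  have {}uB : uniq B by move: uB; apply: map_uniq.
  have gtB : all (gtn (i + j)) B.
    apply/allP => b bB /=; have := allP lB _ bB.
    by have := allP gB (b - i) (map_f _ bB); rewrite /=; clear; lia.
  have gtA : all (gtn (i + j)) A by apply/allP => a /(allP lA) /=; clear; lia.
  have nA : i + j \notin A by apply/negP => /(allP gtA) /=; clear; lia.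
  have nB : i + j \notin B by apply/negP => /(allP gtB) /=; clear; lia.
  have AB a b : a \in A -> b \in B -> a < b.
    by move=> /(allP lA) /= ai /(allP lB) /=; apply: leq_trans.
  have dAB : ~~ has (mem A) B.
    by apply/hasPn => b bB; apply/negP => /= /AB /(_ bB); rewrite ltnn.
  rewrite av231_cat_max ?all_cat ?gtA // avA.
  rewrite -(@av231_map (subn^~ i) B) ?avB /=; last first.
    by move=> x y /(allP lB) + /(allP lB) /=; clear; lia.
  apply/andP; split; last by apply/allrelP => a b aA bB; exact/ltnW/AB.
  rewrite /perm_word size_cat /= sA sB addnS eqxx /= cat_uniq /= uA uB !andbT.
  rewrite negb_or nA nB dAB all_cat /= ltnS leqnn /=; apply/andP; split.
    by apply: sub_all gtA => a /=; clear; lia.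
  by apply: sub_all gtB => a /=; clear; lia.
case/andP=> /and3P[_]; rewrite cat_uniq /= => /and4P[uA].
rewrite negb_or => /andP[nA /hasPn AB] nB uB.
rewrite all_cat /= => /and3P[lA _ lB].
have gtA : all (gtn (i + j)) A.
  apply/allP => a aA; have /= := allP lA a aA.
  by move: nA; have [E|] := eqVneq a (i + j); [rewrite -E aA | by clear; lia].
have gtB : all (gtn (i + j)) B.
  apply/allP => b bB; have /= := allP lB b bB.
  by move: nB; have [E|] := eqVneq b (i + j); [rewrite -E bB | by clear; lia].
rewrite av231_cat_max ?all_cat ?gtA // => /and3P[avA avB /allrelP leAB].
have {}leAB a b : a \in A -> b \in B -> a < b.
  move=> aA bB; have := leAB _ _ aA bB; have [E|] := eqVneq a b; last by clear; lia.
  by have := AB _ bB; rewrite -E aA.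
(* The i entries of A are distinct and below b. *)
have gB : all (leq i) B.
  apply/allP => b bB; rewrite -sA -(size_iota 0 b); apply: uniq_leq_size => // a.
  by move=> /leAB /(_ bB); rewrite mem_iota.
(* The j entries of B are distinct, above a and below i + j. *)
have lA' : all (gtn i) A.
  apply/allP => a aA; suff : size B <= size (iota a.+1 ((i + j).-1 - a)).
    by rewrite sB size_iota; move: (allP gtA _ aA) => /=; clear; lia.
  apply: uniq_leq_size => // b bB.
  by have := leAB _ _ aA bB; have := allP gtB _ bB; rewrite mem_iota /=; clear; lia.
rewrite /perm_word uA avA lA' gB size_map sA sB !eqxx /=.
rewrite av231_map ?avB ?andbT => [|x y /(allP gB) + /(allP gB) /=]; last by clear; lia.
apply/andP; split.
  by rewrite map_inj_in_uniq // => x y /(allP gB) + /(allP gB) /=; clear; lia.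
rewrite all_map; apply/allP => b bB /=.
by have := allP gB _ bB; have := allP gtB _ bB; rewrite /=; clear; lia.
Qed.

(** * Permutations as words, and the Catalan recursion *)

(** 0-based one-line notation: lists can be cut and joined without casts between
    the types ['S_n]. *)
Definition word (n : nat) (sigma : 'S_n) : seq nat :=
  [seq nat_of_ord (sigma i) | i <- enum 'I_n].

Lemma size_word n (sigma : 'S_n) : size (word sigma) = n.
Proof. by rewrite size_map size_enum_ord. Qed.

Lemma nth_word n (sigma : 'S_n) (i : 'I_n) : nth 0 (word sigma) i = sigma i.
Proof. by rewrite (nth_map i) ?size_enum_ord // nth_ord_enum. Qed.

Lemma word_inj n : injective (@word n).
Proof.
move=> s t st; apply/permP => i; apply: val_inj.
by rewrite /= -!nth_word st.
Qed.

Lemma perm_wordP n (w : seq nat) :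
  reflect (exists sigma : 'S_n, w = word sigma) (perm_word n w).
Proof.
apply: (iffP idP) => [/and3P[/eqP sw uw gw]|[s ->]]; last first.
  rewrite /perm_word size_word eqxx /= map_inj_uniq ?enum_uniq.
    by rewrite all_map; apply/allP => i _ /=.
  by move=> i j /val_inj /perm_inj.
have wlt (i : 'I_n) : nth 0 w i < n.
  by apply: (allP gw (nth 0 w i)); rewrite mem_nth // sw.
pose f (i : 'I_n) := Ordinal (wlt i).
have f_inj : injective f.
  move=> i j /(congr1 val) /= /eqP; rewrite nth_uniq ?sw // => /eqP.
  exact: val_inj.
exists (perm f_inj); apply: (@eq_from_nth _ 0); rewrite ?size_word // sw => i ltin.
by rewrite -[i]/(nat_of_ord (Ordinal ltin)) nth_word permE.
Qed.

Definition av_words (n : nat) : seq (seq nat) :=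
  [seq w <- map (@word n) (enum [set: 'S_n]) | av231 w].

Lemma mem_av_words n w : (w \in av_words n) = perm_word n w && av231 w.
Proof.
rewrite mem_filter andbC; congr andb; apply/mapP/perm_wordP => [[s _ ->]|[s ->]].
  by exists s.
by exists s; rewrite ?mem_enum ?inE.
Qed.

Lemma av_words_uniq n : uniq (av_words n).
Proof. by rewrite filter_uniq // map_inj_uniq ?enum_uniq //; apply: word_inj. Qed.

(** The bijection between 231-avoiders of size n+1 and triples consisting of the
    position i of the maximum and a 231-avoider for each of its two sides. *)
Lemma sum_av_words_max n (F : seq nat -> nat) :
  \sum_(w <- av_words n.+1) F w =
  \sum_(i < n.+1) \sum_(A <- av_words i) \sum_(B <- av_words (n - i))
     F (A ++ n :: map (addn i) B).
Proof.
have -> : \sum_(w <- av_words n.+1) F w =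
    \sum_(w <- av_words n.+1) \sum_(i < n.+1 | index n w == i :> nat) F w.
  rewrite big_seq [RHS]big_seq; apply: eq_bigr => w.
  rewrite mem_av_words => /andP[/and3P[/eqP sw uw /allP gw] _].
  have nw : n \in w.
    have [||_ ->] := @uniq_min_size _ w (iota 0 n.+1) uw.
    - by move=> x /gw; rewrite mem_iota.
    - by rewrite size_iota sw.
    by rewrite mem_iota ltnSn.
  have iw : index n w < n.+1 by rewrite -sw index_mem.
  by rewrite (big_pred1 (Ordinal iw)) // => i; rewrite eq_sym.
rewrite (exchange_big_dep predT) //=; apply: eq_bigr => i _.
rewrite -big_filter.
rewrite -(@big_allpairs_dep _ _ addn _ (fun=> _) _
            (fun A B => A ++ n :: map (addn i) B)).
apply: perm_big; apply: uniq_perm; first exact/filter_uniq/av_words_uniq.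
  apply: allpairs_uniq; try exact: av_words_uniq.
  move=> [A B] [A' B'] /allpairsP[[? ?] /= [hA _ [-> ->]]].
  move=> /allpairsP[[? ?] /= [hA' _ [-> ->]]] /eqP.
  move: hA hA'; rewrite !mem_av_words => /andP[/and3P[/eqP sA _ _] _].
  move=> /andP[/and3P[/eqP sA' _ _] _]; rewrite eqseq_cat ?sA ?sA' //.
  by case/andP => /eqP-> /eqP[/(inj_map (@addnI i)) ->].
have lt_in : i <= n := ltn_ord i.
move=> w; rewrite mem_filter; apply/andP/allpairsP => [[/eqP iw]|].
  rewrite mem_av_words => /[dup] /andP[/and3P[/eqP sw _ _] _].
  have nw : n \in w by rewrite -index_mem iw sw.
  have Ew : w = take i w ++ n :: drop i.+1 w.
    by rewrite -{1}(cat_take_drop i w) (drop_nth 0) ?sw // -{2}iw nth_index.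
  have := @perm_word_cat_max i (n - i) (take i w) (drop i.+1 w).
  rewrite subnKC // -Ew size_take size_drop sw subSS ltn_ord => -> // /and5P[].
  move=> pA aA lB pB aB; exists (take i w, map (subn^~ i) (drop i.+1 w)) => /=.
  rewrite !mem_av_words pA aA pB aB; split=> //; rewrite {1}Ew; congr (_ ++ _ :: _).
  rewrite -map_comp map_id_in // => b /(allP lB) /=; lia.
case=> [[A B] /= []]; rewrite !mem_av_words.
case/andP=> pA aA /andP[pB aB] ->; have /and3P[/eqP sA _ gA] := pA.
have /and3P[/eqP sB _ _] := pB.
split.
  rewrite index_cat ifN /= ?eqxx ?addn0 ?sA //.
  by apply/negP => /(allP gA) /=; lia.
have := @perm_word_cat_max i (n - i) A (map (addn i) B) sA.
have E : map (subn^~ i) (map (addn i) B) = B by apply: mapK => x; exact: addKn.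
rewrite subnKC // size_map E => -> //; rewrite pA aA pB aB !andbT.
by apply/allP => _ /mapP[x _ ->] /=; rewrite leq_addr.
Qed.

Definition num_av n := size (av_words n).
Definition total_rl_minima n := \sum_(w <- av_words n) rl_minima w.

Lemma sum_av_words1 n : \sum_(w <- av_words n) 1 = num_av n.
Proof. by rewrite big_const_seq count_predT iter_addn_0 mul1n. Qed.

Lemma av_words0 : av_words 0 = [:: [::]].
Proof.
apply: perm_small_eq => //; apply: uniq_perm => //; first exact: av_words_uniq.
by move=> w; rewrite mem_av_words /perm_word inE size_eq0; case: w.
Qed.

Lemma num_avS n : num_av n.+1 = \sum_(i < n.+1) num_av i * num_av (n - i).
Proof.
rewrite -sum_av_words1 sum_av_words_max; apply: eq_bigr => i _.
under eq_bigr do rewrite sum_av_words1.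
by rewrite big_const_seq count_predT iter_addn_0 mulnC.
Qed.

(** In the sum over B, the summand [B == [::]] of [rl_minima_cat_max] is nonzero only
    for i = n, whence the term [num_av n]; the two convolutions are equal by the
    symmetry i <-> n - i. *)
Lemma total_rl_minimaS n : total_rl_minima n.+1 =
  2 * (\sum_(i < n.+1) total_rl_minima i * num_av (n - i)) + num_av n.
Proof.
have nil_count m : \sum_(w <- av_words m) (w == [::]) = (m == 0).
  case: m => [|m]; first by rewrite av_words0 big_seq1.
  rewrite big_seq big1 // => w; rewrite mem_av_words => /andP[/and3P[/eqP sw _ _] _].
  by case: w sw.
rewrite /total_rl_minima sum_av_words_max.
have -> : \sum_(i < n.+1) \sum_(A <- av_words i) \sum_(B <- av_words (n - i))
     rl_minima (A ++ n :: map (addn i) B) =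
   \sum_(i < n.+1) (total_rl_minima i * num_av (n - i) +
     num_av i * (n - i == 0) + num_av i * total_rl_minima (n - i)).
  apply: eq_bigr => i _.
  have E A : A \in av_words i -> \sum_(B <- av_words (n - i))
     rl_minima (A ++ n :: map (addn i) B) =
     num_av (n - i) * rl_minima A + (n - i == 0) + total_rl_minima (n - i).
    rewrite mem_av_words => /andP[/and3P[/eqP sA _ gA] _].
    rewrite -nil_count /total_rl_minima -sum_av_words1 big_distrl -!big_split /= !big_seq.
    apply: eq_bigr => B; rewrite mem_av_words => /andP[/and3P[/eqP sB _ gB] _].
    have lt_in : i <= n := ltn_ord i.
    rewrite rl_minima_cat_max ?mul1n.
    - congr (_ + _ + _); first by case: (B).
      by rewrite rl_minima_map // => x y _ _; rewrite ltn_add2l.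
    - rewrite all_cat all_map; apply/andP; split; apply/allP => x.
        by move=> /(allP gA) /=; lia.
      by move=> /(allP gB) /=; lia.
    by apply/allrelP => x y /(allP gA) xi /mapP[z _ ->]; exact: ltn_addr.
  rewrite big_seq (eq_bigr _ E) -big_seq !big_split /=.
  rewrite -big_distrr /= -!/(total_rl_minima _) !big_const_seq !count_predT !iter_addn_0.
  by rewrite -/(num_av _); ring.
rewrite !big_split /=.
have -> : \sum_(i < n.+1) num_av i * (n - i == 0) = num_av n.
  rewrite big_ord_recr /= subnn muln1 big1 ?add0n // => i _.
  by rewrite subn_eq0 leqNgt ltn_ord muln0.
have -> : \sum_(i < n.+1) num_av i * total_rl_minima (n - i) =
    \sum_(i < n.+1) total_rl_minima i * num_av (n - i).
  rewrite (reindex_inj rev_ord_inj) /=; apply: eq_bigr => i _.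
  by rewrite subSS subKn 1?mulnC // -ltnS.
rewrite -!/(total_rl_minima _); ring.
Qed.

(** By the symmetry i <-> n - i of the convolution, the average of i is n / 2; this
    turns the convolution into a linear recursion without generating functions. *)
Lemma sum_num_av_affine n c e :
  2 * (\sum_(i < n.+1) (c * i + e) * (num_av i * num_av (n - i))) =
  (c * n + 2 * e) * num_av n.+1.
Proof.
rewrite mul2n -addnn {2}(reindex_inj rev_ord_inj) /= -big_split /= num_avS.
rewrite big_distrr /=; apply: eq_bigr => i _.
have lt_in : i <= n := ltn_ord i.
rewrite subSS subKn // [X in _ + _ * X]mulnC -mulnDl; congr (_ * _).
by rewrite mulnBr addnACA subnKC ?leq_mul2l ?lt_in ?orbT //; lia.
Qed.

(** Both sides of the step from n to n+1 compute twice the sum of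
    (i+1) C_i C_(n+1-i) over i <= n+1: once by [sum_num_av_affine], once by
    rewriting (i+2) C_(i+1) as (4i+2) C_i. *)
Lemma num_av_rec n : n.+2 * num_av n.+1 = (4 * n + 2) * num_av n.
Proof.
elim/ltn_ind: n => [[|n]] IH.
  by rewrite num_avS big_ord1 /= /num_av av_words0.
have := sum_num_av_affine n.+1 1 1.
rewrite big_ord_recl /= subn0 muln0 !mul1n.
have -> : \sum_(i < n.+1) (1 * bump 0 i + 1) *
      (num_av (bump 0 i) * num_av (n.+1 - bump 0 i)) =
    \sum_(i < n.+1) (4 * i + 2) * (num_av i * num_av (n - i)).
  apply: eq_bigr => i _; rewrite /bump leq0n add1n mul1n addn1 subSS !mulnA IH //.
rewrite mulnDr sum_num_av_affine {1}/num_av av_words0 /=; lia.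
Qed.

Lemma central_bin_rec n :
  n.+1 * 'C(2 * n.+1, n.+1) = 2 * (2 * n).+1 * 'C(2 * n, n).
Proof.
have -> : 2 * n.+1 = (2 * n).+2 by lia.
have mid : 'C((2 * n).+1, n.+1) = 'C((2 * n).+1, n).
  by rewrite -bin_sub; [congr binomial|]; lia.
by rewrite binS -mid addnn -mul2n mulnCA -(mul_bin_diag (2 * n).+1 n) /= mulnA.
Qed.

Lemma num_av_catalan n : n.+1 * num_av n = 'C(2 * n, n).
Proof.
elim: n => [|n IH]; first by rewrite /num_av av_words0.
apply/eqP; rewrite -(@eqn_pmul2l n.+1) // central_bin_rec num_av_rec -IH.
by rewrite mulnCA; apply/eqP; congr (_ * _); lia.
Qed.

(** A 231-avoider has on average (n+1)/2 right-to-left minima for n > 0.  The empty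
    word has none instead of 1/2; the summand [n == 0] makes the formula uniform,
    and in the recursion it contributes exactly the term [num_av n]. *)
Lemma total_rl_minima_eq n : 2 * total_rl_minima n + (n == 0) = n.+1 * num_av n.
Proof.
elim/ltn_ind: n => [[|n]] IH.
  by rewrite /total_rl_minima /num_av av_words0 big_seq1.
rewrite total_rl_minimaS /= addn0.
have := sum_num_av_affine n 1 1; rewrite !mul1n.
have -> : \sum_(i < n.+1) (1 * i + 1) * (num_av i * num_av (n - i)) =
    2 * (\sum_(i < n.+1) total_rl_minima i * num_av (n - i)) + num_av n.
  rewrite big_distrr /= -[num_av n in RHS]mul1n.
  have -> : 1 * num_av n = \sum_(i < n.+1) (i == 0 :> nat) * num_av (n - i).
    rewrite big_ord_recl /= subn0 big1 ?addn0 // => i _.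
  rewrite -big_split; apply: eq_bigr => i _ /=.
  by rewrite mul1n addn1 mulnA -IH // mulnDl mulnA.
by rewrite muln1 addn2.
Qed.

(** * Inflating a point of a 231-avoiding word *)

(** A block of letters that r does not distinguish from l behaves like the single
    letter l. *)
Lemma pairwise_block (r : rel nat) (l : nat) (X T Y : seq nat) :
  T != [::] -> r l l -> {in T, forall y, r y =1 r l} ->
  {in T, forall y z, r z y = r z l} ->
  pairwise r (X ++ T ++ Y) = pairwise r (X ++ l :: Y).
Proof.
move=> T0 rll rTl rTr.
have allT (p : pred nat) (b : bool) : {in T, forall y, p y = b} -> all p T = b.
  move=> pb; rewrite (eq_in_all pb); case: T T0 {rTl rTr pb} => //= _ T _.
  by case: b; [rewrite all_predT | ].
have rT : pairwise r T.
  by apply: pairwise_in2W => y z yT zT; rewrite rTl // rTr.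
have rTY : allrel r T Y = all (r l) Y.
  by apply: allT => y yT; apply: eq_all; apply: rTl.
have rXT : allrel r X T = all (r^~ l) X.
  by apply: eq_all => x; apply: allT => y yT; apply: rTr.
rewrite !pairwise_cat /= rT rTY allrel_catr rXT allrel_consr.
by rewrite !andbA.
Qed.

(** The occurrences of 231 in T ++ Y that are not visible in T or in l :: Y are
    those with 2 and 3 in T and 1 in Y, that is, an ascent of T followed by an
    entry of Y below the block. *)
Lemma av231_block_cat (l k : nat) (T Y : seq nat) :
  {in T, forall y, l <= y < l + k} -> {in Y, forall z, ~~ (l <= z < l + k)} ->
  av231 (T ++ Y) =
  [&& av231 Y, (T == [::]) || pairwise (fun y z => ~~ (z < l < y)) Y,
      av231 T & pairwise geq T || all (ltn l) Y].
Proof.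
move=> + Yl; elim: T => [|x T IH] Tl /=; first by rewrite !andbT.
have xl : l <= x < l + k by apply: Tl; rewrite mem_head.
rewrite IH => [|y yT]; last by apply: Tl; rewrite inE yT orbT.
rewrite pairwise_cat.
have -> : pairwise (fun y z => ~~ (z < x < y)) Y =
          pairwise (fun y z => ~~ (z < l < y)) Y.
  apply: (@eq_in_pairwise _ (mem Y)) (allss Y) => y z /Yl + /Yl /=; lia.
have -> : allrel (fun y z => ~~ (z < x < y)) T Y = all (geq x) T || all (ltn l) Y.
  apply/idP/orP => [/allrelP H|[/allP H|/allP H]]; last 2 first.
  - by apply/allrelP => y z yT zY; have /= := H y yT; lia.
  - by apply/allrelP => y z yT zY; have /= := H z zY; have := Yl z zY; lia.
  have [|/allPn[y yT xy]] := boolP (all (geq x) T); first by left.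
  right; apply/allP => z zY; have := H y z yT zY; have := Yl z zY.
  by move: xy => /=; lia.
move: (av231 Y) (av231 T) (pairwise _ Y) (pairwise _ T) (pairwise geq T).
by move: (all _ T) (all _ Y) (T == [::]); do !case.
Qed.

(** Entries to the left of the block create no further obstruction: two points of
    the block are adjacent in value, so no outer entry separates them as 2
    separates 1 from 3. *)
Lemma av231_block (l k : nat) (X T Y : seq nat) : T != [::] ->
  {in T, forall y, l <= y < l + k} ->
  {in X ++ Y, forall z, ~~ (l <= z < l + k)} ->
  av231 (X ++ T ++ Y) =
  [&& av231 (X ++ l :: Y), av231 T & pairwise geq T || all (ltn l) Y].
Proof.
move=> T0 Tl; elim: X => [|a X IH] Al /=.
  rewrite (av231_block_cat Tl) // (negPf T0) /=.
  by rewrite -!andbA.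
rewrite IH => [|z zXY]; last by apply: Al; rewrite inE zXY orbT.
have al : ~~ (l <= a < l + k) by apply: Al; rewrite mem_head.
rewrite (@pairwise_block _ l) //.
- by rewrite -!andbA; do !bool_congr.
- by lia.
- by move=> y /Tl yl z; lia.
by move=> y /Tl yl z; lia.
Qed.

(** The relabelling of the letters other than l that makes room for the block
    l, ..., l+k-1; [deflate] undoes it outside the block. *)
Definition inflate (l k x : nat) : nat := if x <= l then x else x + k.-1.
Definition deflate (l k x : nat) : nat := if x <= l then x else x - k.-1.

Section Inflation.
Variables (k l N : nat) (t : seq nat).
Hypotheses (k_gt0 : 0 < k) (lN : l < N) (pt : perm_word k t).
Let T := map (addn l) t.

Let Tl : {in T, forall y, l <= y < l + k}.
Proof. by move=> _ /mapP[i it ->]; case/and3P: pt => _ _ /allP/(_ i it) /=; lia. Qed.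

Let T0 : T != [::].
Proof. by case/and3P: pt => /eqP st _ _; rewrite -size_eq0 size_map st; lia. Qed.

Lemma inflate_block x : x != l -> ~~ (l <= inflate l k x < l + k).
Proof. by move: k_gt0; rewrite /inflate; case: (leqP x l); lia. Qed.

Lemma inflate_mono : {mono inflate l k : x y / x < y}.
Proof. by move=> x y; rewrite /inflate; case: (leqP x l); case: (leqP y l); lia. Qed.

Lemma inflate_inj : injective (inflate l k).
Proof. by move=> x y; rewrite /inflate; case: (leqP x l); case: (leqP y l); lia. Qed.

Lemma deflateK x : ~~ (l <= x < l + k) -> inflate l k (deflate l k x) = x.
Proof.
move: k_gt0; rewrite /inflate /deflate; case: (leqP x l) => ?.
  by case: (leqP x l); lia.
by case: (leqP (x - k.-1) l); lia.
Qed.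

Lemma perm_word_inflate (A B : seq nat) : l \notin A ++ B ->
  perm_word (N + k.-1) (map (inflate l k) A ++ T ++ map (inflate l k) B) =
  perm_word N (A ++ l :: B).
Proof.
move=> lAB; have [/eqP st ut _] := and3P pt.
rewrite /perm_word; congr [&& _, _ & _].
- by rewrite !size_cat /= !size_map st; lia.
- rewrite uniq_catCA -map_cat -[l :: B]cat1s [in RHS]uniq_catCA /= lAB.
  rewrite cat_uniq (map_inj_uniq inflate_inj) (map_inj_uniq (@addnI l)) ut /=.
  rewrite andb_idl // => _; apply/hasPn => _ /mapP[x xAB ->].
  apply/negP => /= /Tl; apply/negP/inflate_block.
  by apply: contraNneq lAB => <-.
have E s : all (gtn (N + k.-1)) (map (inflate l k) s) = all (gtn N) s.
  by rewrite all_map; apply: eq_all => x /=; rewrite /inflate; case: (leqP x l); lia.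
rewrite !all_cat !E /= lN (_ : all _ T) //.
by apply/allP => y /Tl /=; lia.
Qed.

Lemma av231_inflate (A B : seq nat) : l \notin A ++ B -> av231 t ->
  av231 (map (inflate l k) A ++ T ++ map (inflate l k) B) =
  av231 (A ++ l :: B) && (pairwise geq t || all (ltn l) B).
Proof.
move=> lAB avt; rewrite (av231_block (k := k) T0 Tl); last first.
  rewrite -map_cat => _ /mapP[x xAB ->]; apply: inflate_block.
  by apply: contraNneq lAB => <-.
have -> : map (inflate l k) A ++ l :: map (inflate l k) B =
    map (inflate l k) (A ++ l :: B).
  by rewrite map_cat /= [inflate l k l]/inflate leqnn.
rewrite !av231_map ?avt /= => [|x y _ _|x y _ _]; last 2 first.
- exact: ltn_add2l.
- exact: inflate_mono.
congr (_ && (_ || _)).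
  by rewrite pairwise_map; apply: eq_pairwise => x y /=; rewrite leq_add2l.
by rewrite all_map; apply: eq_all => x /=; rewrite /inflate; case: (leqP x l); lia.
Qed.

(** Inflation and collapse, at fixed position m and value l, are inverse to each
    other; the condition on the right says that t is decreasing or that the
    marked letter l is a right-to-left minimum. *)
Lemma count_inflate m : m < N -> av231 t ->
  count (fun w => take k (drop m w) == T) (av_words (N + k.-1)) =
  count (fun u => (nth 0 u m == l) &&
                  (pairwise geq t || all (ltn l) (drop m.+1 u))) (av_words N).
Proof.
move=> mN avt; have [/eqP st _ _] := and3P pt.
pose f u := map (inflate l k) (take m u) ++ T ++ map (inflate l k) (drop m.+1 u).
pose Q w := take k (drop m w) == T.
pose P u := (nth 0 u m == l) && (pairwise geq t || all (ltn l) (drop m.+1 u)).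
rewrite -/Q -/P -!size_filter -(size_map f (seq.filter P _)).
have cut u : u \in av_words N -> nth 0 u m == l ->
    u = take m u ++ l :: drop m.+1 u /\ l \notin take m u ++ drop m.+1 u.
  rewrite mem_av_words => /andP[/and3P[/eqP su uu _] _] /eqP ul.
  have Eu : u = take m u ++ l :: drop m.+1 u.
    by rewrite -{1}(cat_take_drop m u) (drop_nth 0) ?su // ul.
  by split=> //; move: uu; rewrite {1}Eu uniq_catC /= mem_cat orbC -mem_cat => /andP[].
apply: perm_size; apply: uniq_perm; first exact/filter_uniq/av_words_uniq.
  rewrite map_inj_in_uniq; first exact/filter_uniq/av_words_uniq.
  move=> u v.
  rewrite !(mem_filter P) => /andP[/andP[ul _] uW] /andP[/andP[vl _] vW] /eqP.
  have [Eu _] := cut u uW ul; have [Ev _] := cut v vW vl.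

  move: uW vW; rewrite !mem_av_words => /andP[/and3P[/eqP su _ _] _].
  move=> /andP[/and3P[/eqP sv _ _] _].
  rewrite /f eqseq_cat ?size_map ?size_take ?su ?sv // eqseq_cat // eqxx /=.
  case/andP => /eqP/(inj_map inflate_inj) Et /eqP/(inj_map inflate_inj) Ed.
  by rewrite Eu Ev Et Ed.
move=> w; rewrite (mem_filter Q); apply/andP/mapP => [[/eqP wT]|[u]].
  rewrite mem_av_words => /andP[pw aw].
  have [/eqP sw uw _] := and3P pw.
  have Ew : w = take m w ++ T ++ drop (m + k) w.
    by rewrite -wT addnC -drop_drop !cat_take_drop.
  have nT x : x \in take m w ++ drop (m + k) w -> ~~ (l <= x < l + k).
    move=> xw; apply/negP => xl.
    (* T consists of k distinct letters of the interval, hence of all of them. *)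
    have xT : x \in T.
      have uT : uniq T by rewrite map_inj_uniq; [case/and3P: pt | exact: addnI].
      have [||_ ->] := uniq_min_size uT (s2 := iota l k).
      - by move=> y /Tl; rewrite mem_iota.
      - by rewrite size_iota size_map st.
      by rewrite mem_iota.
    move: uw; rewrite Ew uniq_catCA cat_uniq => /and3P[_ /hasPn/(_ x xw)].
    by rewrite xT.
  pose A := map (deflate l k) (take m w).
  pose B := map (deflate l k) (drop (m + k) w).
  have sA : size A = m by rewrite size_map size_takel // sw; lia.
  have EA : map (inflate l k) A = take m w.
    rewrite -map_comp map_id_in // => x xA; apply/deflateK/nT.
    by rewrite mem_cat xA.
  have EB : map (inflate l k) B = drop (m + k) w.
    rewrite -map_comp map_id_in // => x xB; apply/deflateK/nT.
    by rewrite mem_cat xB orbT.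
  have lAB : l \notin A ++ B.
    apply/negP => lAB; have : inflate l k l \in map (inflate l k) (A ++ B).
      by rewrite map_f.
    by rewrite map_cat EA EB => /nT; rewrite /inflate leqnn; lia.
  move: pw aw; rewrite Ew -EA -EB perm_word_inflate // av231_inflate // EA EB.
  move=> pu /andP[au cu]; exists (A ++ l :: B).
    rewrite (mem_filter P) mem_av_words pu au /P nth_cat sA ltnn subnn eqxx /=.
    by rewrite -cat_rcons drop_size_cat ?size_rcons ?sA // cu.
  by rewrite /f take_size_cat // -cat_rcons drop_size_cat ?size_rcons ?sA // EA EB.
rewrite (mem_filter P) => /andP[/andP[ul cu] uW] ->.
have [Eu lu] := cut u uW ul.
move: (uW); rewrite !mem_av_words => /andP[pu au]; have [/eqP su _ _] := and3P pu.
rewrite /f perm_word_inflate // av231_inflate // -Eu pu au cu; split=> //.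
have sm : size (map (inflate l k) (take m u)) = m.
  by rewrite size_map size_takel // su ltnW.
by rewrite /Q drop_size_cat // take_size_cat ?size_map.
Qed.

End Inflation.

Lemma rl_minima_sum (u : seq nat) :
  rl_minima u = \sum_(m < size u) all (ltn (nth 0 u m)) (drop m.+1 u).
Proof.
elim: u => [|x u IH] /=; first by rewrite big_ord0.
by rewrite big_ord_recl /= drop0 IH.
Qed.

Definition occurs (t w : seq nat) (l m : nat) : bool :=
  take (size t) (drop m w) == map (addn l) t.

(** Summing [count_inflate] over l and m marks every letter of u when t is
    decreasing, and its right-to-left minima otherwise. *)
Lemma sum_occurs (k N : nat) (t : seq nat) : 0 < k -> perm_word k t -> av231 t ->
  \sum_(w <- av_words (N + k.-1)) \sum_(l < N) \sum_(m < N) occurs t w l m =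
  if pairwise geq t then N * num_av N else total_rl_minima N.
Proof.
move=> k0 pt avt; have [/eqP st _ _] := and3P pt.
rewrite exchange_big /=.
transitivity (\sum_(u <- av_words N) \sum_(m < N)
     (pairwise geq t || all (ltn (nth 0 u m)) (drop m.+1 u) : nat)).
  transitivity (\sum_(l < N) \sum_(u <- av_words N) \sum_(m < N)
    ((nth 0 u m == l) && (pairwise geq t || all (ltn l) (drop m.+1 u)) : nat)).
    apply: eq_bigr => l _; rewrite exchange_big [RHS]exchange_big.
    apply: eq_bigr => m _ /=.
    have sumC s (P : pred (seq nat)) : \sum_(w <- s) (P w : nat) = count P s.
      by rewrite -sum1_count [RHS]big_mkcond; apply: eq_bigr => w _; case: (P w).
    by rewrite !sumC /occurs st; apply: count_inflate.
  rewrite exchange_big /= big_seq [RHS]big_seq; apply: eq_bigr => u.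
  rewrite mem_av_words => /andP[/and3P[/eqP su _ /allP gu] _].
  rewrite exchange_big; apply: eq_bigr => m _ /=.
  have um : nth 0 u m < N by apply: gu; rewrite mem_nth // su.
  rewrite (bigD1 (Ordinal um)) //= eqxx big1 ?addn0 // => l /negPf.
  by rewrite -val_eqE /= eq_sym => ->.
case: (pairwise geq t) => /=.
  under eq_bigr do rewrite sum1_card card_ord.
  by rewrite big_const_seq count_predT iter_addn_0.
rewrite /total_rl_minima big_seq [RHS]big_seq; apply: eq_bigr => u.
by rewrite mem_av_words => /andP[/and3P[/eqP su _ _] _]; rewrite rl_minima_sum su.
Qed.

Lemma occursP (k n l m : nat) (tau : 'S_k) (sigma : 'S_n) : m + k <= n ->
  reflect (forall (i : 'I_k) (j : 'I_n), j = m + i :> nat -> sigma j = l + tau i :> nat)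
          (occurs (word tau) (word sigma) l m).
Proof.
move=> mk; apply: (iffP eqP) => [E i j ji|E].
  rewrite -!nth_word ji -nth_drop -(@nth_take k) //.
  by rewrite -{1}(size_word tau) E (nth_map 0) ?size_word.
apply: (@eq_from_nth _ 0).
  by rewrite size_map size_takel // size_drop !size_word; lia.
rewrite size_takel ?size_drop !size_word; last by lia.
move=> i ik; rewrite nth_take // nth_drop (nth_map 0) ?size_word //.
have mi : m + i < n by lia.
rewrite -[i]/(nat_of_ord (Ordinal ik)) -[m + _]/(nat_of_ord (Ordinal mi)) !nth_word.
exact: E.
Qed.

(** In the definition of [clusters] the equality of the block of values with the
    image of the block of positions follows from the pointwise condition. *)
Lemma clusters_word (k n : nat) (tau : 'S_k) (sigma : 'S_n) : k <= n ->
  clusters tau sigma =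
  \sum_(l < n.+1 - k) \sum_(m < n.+1 - k) occurs (word tau) (word sigma) l m.
Proof.
move=> kn; rewrite /clusters -sum1_card pair_big /= big_mkcond /=.
apply: eq_bigr => -[l m] _; rewrite inE /=.
set b := (X in if X then _ else _); suff -> : b = occurs (word tau) (word sigma) l m.
  by case: occurs.
rewrite {}/b; have mk : m + k <= n by have := ltn_ord m; lia.
apply/andP/(occursP l tau sigma mk) => [[_ /forallP H] i j ji|H].
  by have /forallP/(_ j)/implyP/(_ _)/eqP := H i; apply; apply/eqP.
split; last first.
  by apply/forallP => i; apply/forallP => j; apply/implyP => /eqP/H ->.
apply/eqP/setP => v; rewrite inE; apply/idP/imsetP => [vl|[j]].
  have vlk : v - l < k by lia.
  pose i := (tau^-1 (Ordinal vlk))%g.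
  have mi : m + i < n by have := ltn_ord i; lia.
  exists (Ordinal mi); first by rewrite inE /=; have := ltn_ord i; lia.
  by apply: val_inj; rewrite /= (H i) // permKV /=; lia.
rewrite inE => jm ->; have jmk : j - m < k by lia.
by rewrite (H (Ordinal jmk)) /=; have := ltn_ord (tau (Ordinal jmk)); lia.
Qed.

(** * The exact count for the pattern 231 *)

Lemma av231P (w : seq nat) :
  reflect (forall i j l, i < j -> j < l -> l < size w ->
             ~~ (nth 0 w l < nth 0 w i < nth 0 w j)) (av231 w).
Proof.
elim: w => [|x w IH] /=; first by left.
apply: (iffP andP) => [[/IH avw /(pairwiseP 0) pw] [|i] [|j] [|l] //= ij jl lw|H].
- by apply: (pw j l) => //; rewrite inE //; lia.
- exact: avw.
split; first by apply/IH => i j l ij jl lw; apply: (H i.+1 j.+1 l.+1).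
apply/(pairwiseP 0) => j l; rewrite !inE => jw lw jl.
exact: (H 0 j.+1 l.+1).
Qed.

Lemma oneline3 (eta : 'S_3) (a b c : nat) : oneline eta = [:: a; b; c] ->
  [/\ (eta ord0).+1 = a, (eta (@Ordinal 3 1 isT)).+1 = b &
      (eta (@Ordinal 3 2 isT)).+1 = c].
Proof.
rewrite /oneline.
have -> : enum 'I_3 = [:: ord0; @Ordinal 3 1 isT; @Ordinal 3 2 isT].
  by apply: (inj_map val_inj); rewrite val_enum_ord.
by case.
Qed.

Lemma contains_231 (eta : 'S_3) (n : nat) (sigma : 'S_n) :
  oneline eta = [:: 2; 3; 1] -> contains_pattern eta sigma = ~~ av231 (word sigma).
Proof.
move=> /oneline3[e0 e1 e2].
apply/idP/idP => [/existsP[f /andP[/forallP f_incr /forallP f_ord]]|].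
  have fltP (i j : 'I_3) : i < j -> f i < f j by have /forallP/(_ j)/implyP := f_incr i.
  have fordP i j : (sigma (f i) < sigma (f j)) = (eta i < eta j).
    by have /forallP/(_ j)/eqP := f_ord i.
  apply/negP => /av231P.
  move=> /(_ (f ord0) (f (@Ordinal 3 1 isT)) (f (@Ordinal 3 2 isT))).
  rewrite !fltP // size_word ltn_ord => /(_ isT isT isT).
  by rewrite !nth_word !fordP; lia.
apply: contraR => /existsPn nf; apply/av231P => i j l ij jl; rewrite size_word => ln.
apply/negP => sl.
have jn : j < n by lia. have in_ : i < n by lia.
pose f := [ffun x : 'I_3 => nth (Ordinal ln) [:: Ordinal in_; Ordinal jn; Ordinal ln] x].
have := nf f; apply/negP/negPn.
move: sl; rewrite -[i]/(nat_of_ord (Ordinal in_)) -[j]/(nat_of_ord (Ordinal jn)).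
rewrite -[l]/(nat_of_ord (Ordinal ln)) !nth_word => sl.
have I3 (x : 'I_3) : [\/ x = ord0, x = @Ordinal 3 1 isT | x = @Ordinal 3 2 isT].
  by case: x => [[|[|[|//]]] xP]; [constructor 1|constructor 2|constructor 3];
    apply: val_inj.
apply/andP; split; apply/forallP => x; apply/forallP => y;
  case: (I3 x) => ->; case: (I3 y) => ->; rewrite !ffunE /=; lia.
Qed.

Lemma sum_av_231 (eta : 'S_3) (n : nat) (F : seq nat -> nat) :
  oneline eta = [:: 2; 3; 1] ->
  \sum_(sigma in av eta n) F (word sigma) = \sum_(w <- av_words n) F w.
Proof.
move=> eta231; rewrite big_filter big_map big_enum_cond /=.
by apply: eq_bigl => s; rewrite !inE contains_231 // negbK.
Qed.

(** The one-line notation of any permutation rearranges 0, ..., k-1, and there is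
    only one decreasing rearrangement. *)
Lemma decreasing_word (k : nat) (tau : 'S_k) :
  pairwise geq (word tau) = (tau == perm (@rev_ord_inj k)).
Proof.
have wordE (s : 'S_k) : perm_eq (word s) (iota 0 k).
  have /and3P[/eqP sw uw /allP gw] : perm_word k (word s) by apply/perm_wordP; exists s.
  apply: uniq_perm; rewrite ?iota_uniq //.
  have [||_ //] := uniq_min_size uw (s2 := iota 0 k).
    by move=> x /gw; rewrite mem_iota.
  by rewrite size_iota sw.
have geq_tr : transitive geq by move=> x y z yx xz; exact: leq_trans xz yx.
have rev_sorted : pairwise geq (word (perm (@rev_ord_inj k))).
  apply/(pairwiseP 0) => i j; rewrite !inE !size_word => ik jk ij.
  rewrite -[i]/(nat_of_ord (Ordinal ik)) -[j]/(nat_of_ord (Ordinal jk)) !nth_word.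
  by rewrite !permE /=; lia.
apply/idP/eqP => [dec|-> //]; apply: word_inj.
apply: (sorted_eq geq_tr); rewrite ?sorted_pairwise //.
  by move=> x y /=; lia.
by rewrite (permPl (wordE _)) perm_sym.
Qed.

Lemma total_clusters_231 (eta : 'S_3) (k n : nat) (tau : 'S_k) :
  oneline eta = [:: 2; 3; 1] -> 0 < k <= n -> tau \in av eta k ->
  \sum_(sigma in av eta n) clusters tau sigma =
  if tau == tau_star eta k then (n.+1 - k) * num_av (n.+1 - k)
  else total_rl_minima (n.+1 - k).
Proof.
move=> eta231 /andP[k0 kn]; rewrite inE contains_231 // negbK => avtau.
under eq_bigr do rewrite clusters_word //.
rewrite (sum_av_231 _ (fun w => \sum_(l < n.+1 - k) \sum_(m < n.+1 - k)
  occurs (word tau) w l m)) //.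
rewrite -{1}(_ : n.+1 - k + k.-1 = n) ?(@sum_occurs k) //; last by lia.
  by rewrite decreasing_word /tau_star eta231.
by apply/perm_wordP; exists tau.
Qed.

(** * Reduction of the other three patterns to 231 *)

(** The exact counts in the form in which they are carried from one pattern to
    another; the case distinction refers to [tau_star], which depends on eta. *)
Definition cluster_counts (eta : 'S_3) : Prop :=
  forall n, #|av eta n| = num_av n /\
  forall k (tau : 'S_k), 0 < k <= n -> tau \in av eta k ->
  \sum_(sigma in av eta n) clusters tau sigma =
  if tau == tau_star eta k then (n.+1 - k) * num_av (n.+1 - k)
  else total_rl_minima (n.+1 - k).

Definition flip (n : nat) : 'S_n := perm (@rev_ord_inj n).

Lemma flipE n (i : 'I_n) : flip n i = rev_ord i.
Proof. by rewrite permE. Qed.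

Lemma flipK n : (flip n * flip n = 1)%g.
Proof. by apply/permP => i; rewrite permM perm1 !flipE rev_ordK. Qed.

Definition reversal n (s : 'S_n) : 'S_n := (flip n * s)%g.
Definition complement n (s : 'S_n) : 'S_n := (s * flip n)%g.

Lemma reversalK n : involutive (@reversal n).
Proof. by move=> s; rewrite /reversal mulgA flipK mul1g. Qed.

Lemma complementK n : involutive (@complement n).
Proof. by move=> s; rewrite /complement -mulgA flipK mulg1. Qed.

Lemma contains_reversal m n (eta : 'S_m) (sigma : 'S_n) :
  contains_pattern (reversal eta) (reversal sigma) = contains_pattern eta sigma.
Proof.
suff H (e : 'S_m) (s : 'S_n) :
    contains_pattern e s -> contains_pattern (reversal e) (reversal s).
  by apply/idP/idP => /H //; rewrite !reversalK.
case/existsP => f /andP[/forallP f_incr /forallP f_ord].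
apply/existsP; exists [ffun j => rev_ord (f (rev_ord j))].
apply/andP; split; apply/forallP => i; apply/forallP => j; rewrite !ffunE.
  apply/implyP => ij; have /forallP/(_ (rev_ord i))/implyP := f_incr (rev_ord j).
  have := ltn_ord (f (rev_ord i)); have := ltn_ord (f (rev_ord j)) => /=.
  by have := ltn_ord i; have := ltn_ord j; lia.
rewrite !permM !flipE !rev_ordK.
by have /forallP/(_ (rev_ord j)) := f_ord (rev_ord i).
Qed.

Lemma ltn_rev_ord n (i j : 'I_n) : (rev_ord i < rev_ord j) = (j < i).
Proof. by have := ltn_ord i; have := ltn_ord j => /=; case: (ltnP j i); lia. Qed.

Lemma contains_complement m n (eta : 'S_m) (sigma : 'S_n) :
  contains_pattern (complement eta) (complement sigma) = contains_pattern eta sigma.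
Proof.
suff H (e : 'S_m) (s : 'S_n) :
    contains_pattern e s -> contains_pattern (complement e) (complement s).
  by apply/idP/idP => /H //; rewrite !complementK.
case/existsP => f /andP[f_incr /forallP f_ord].
apply/existsP; exists f; rewrite f_incr; apply/forallP => i; apply/forallP => j.
rewrite !permM !flipE !ltn_rev_ord.
by have /forallP/(_ i) := f_ord j.
Qed.

Lemma clusters_reversal k n (tau : 'S_k) (sigma : 'S_n) : k <= n ->
  clusters (reversal tau) (reversal sigma) = clusters tau sigma.
Proof.
move=> kn; rewrite !clusters_word //; apply: eq_bigr => l _.
rewrite [RHS](reindex_inj rev_ord_inj); apply: eq_bigr => m _ /=.
have mk : m + k <= n by have := ltn_ord m; lia.
have mk' : n.+1 - k - m.+1 + k <= n by lia.
congr nat_of_bool; apply/(occursP _ _ _ mk)/(occursP _ _ _ mk') => H i j E.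
  have := H (rev_ord i) (rev_ord j); rewrite !permM !flipE !rev_ordK; apply=> /=.
  by have := ltn_ord i; lia.
rewrite !permM !flipE; apply: H => /=.
by have := ltn_ord i; lia.
Qed.

Lemma clusters_complement k n (tau : 'S_k) (sigma : 'S_n) : k <= n ->
  clusters (complement tau) (complement sigma) = clusters tau sigma.
Proof.
move=> kn; rewrite !clusters_word // [RHS](reindex_inj rev_ord_inj).
apply: eq_bigr => l _; apply: eq_bigr => m _ /=.
have mk : m + k <= n by have := ltn_ord m; lia.
congr nat_of_bool; apply/(occursP _ _ _ mk)/(occursP _ _ _ mk) => H i j E.
  have := H i j E; rewrite !permM !flipE /=.
  by have := ltn_ord (tau i); have := ltn_ord (sigma j); have := ltn_ord l; lia.
have := H i j E; rewrite !permM !flipE /=.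
by have := ltn_ord (tau i); have := ltn_ord (sigma j); have := ltn_ord l; lia.
Qed.

Lemma cluster_counts_transfer (h : forall n, 'S_n -> 'S_n) (eta : 'S_3) :
  (forall n, involutive (h n)) ->
  (forall m n (e : 'S_m) (s : 'S_n),
     contains_pattern (h m e) (h n s) = contains_pattern e s) ->
  (forall k n (tau : 'S_k) (s : 'S_n), k <= n ->
     clusters (h k tau) (h n s) = clusters tau s) ->
  (forall k, h k (tau_star (h 3 eta) k) = tau_star eta k) ->
  cluster_counts (h 3 eta) -> cluster_counts eta.
Proof.
move=> hK h_contains h_clusters h_star H n.
have h_av m (s : 'S_m) : (h m s \in av (h 3 eta) m) = (s \in av eta m).
  by rewrite !inE h_contains.
have h_inj m : injective (h m) := inv_inj (hK m).
have [cardn sumn] := H n; split.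
  rewrite -cardn -(card_imset _ (h_inj n)); apply: eq_card => s.
  by rewrite -[s]hK h_av (mem_imset _ _ (h_inj n)).
move=> k tau /[dup] /andP[_ kn] /sumn H' tau_av.
rewrite -(inj_eq (h_inj k)) -{1}h_star hK -H' ?h_av //.
rewrite [RHS](reindex_inj (h_inj n)).
by apply: eq_big => s; rewrite ?h_av // => _; rewrite h_clusters.
Qed.

Lemma oneline_word n (s : 'S_n) : oneline s = map S (word s).
Proof. by rewrite /word -map_comp. Qed.

Lemma cluster_counts_231 (eta : 'S_3) : oneline eta = [:: 2; 3; 1] -> cluster_counts eta.
Proof.
move=> e n; split; last by move=> k tau kn; exact: total_clusters_231.
by rewrite -sum1_card -(sum_av_words1 n) -(sum_av_231 _ (fun=> 1) e).
Qed.

Lemma oneline_reversal n (s : 'S_n) : oneline (reversal s) = rev (oneline s).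
Proof.
rewrite !oneline_word -map_rev; congr map; apply: (@eq_from_nth _ 0).
  by rewrite size_rev !size_word.
rewrite size_word => i ltin; rewrite nth_rev ?size_word //.
have rin : n - i.+1 < n by lia.
rewrite -[i in LHS]/(nat_of_ord (Ordinal ltin)) -[n - _]/(nat_of_ord (Ordinal rin)).
by rewrite !nth_word permM flipE; congr (nat_of_ord (s _)); apply: val_inj.
Qed.

Lemma oneline_complement n (s : 'S_n) :
  oneline (complement s) = map (subn n.+1) (oneline s).
Proof.
rewrite /oneline -map_comp; apply: eq_map => i /=.
by rewrite permM flipE /=; have := ltn_ord (s i); lia.
Qed.

Lemma cluster_counts_all (eta : 'S_3) :
  oneline eta \in [:: [:: 1; 3; 2]; [:: 2; 1; 3]; [:: 2; 3; 1]; [:: 3; 1; 2]] ->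
  cluster_counts eta.
Proof.
have r231 (e : 'S_3) : oneline e = [:: 1; 3; 2] -> cluster_counts e.
  move=> e132; have er : oneline (reversal e) = [:: 2; 3; 1].
    by rewrite oneline_reversal e132.
  apply: (cluster_counts_transfer (h := reversal)); last exact: cluster_counts_231.
  - exact: reversalK.
  - exact: contains_reversal.
  - exact: clusters_reversal.
  by move=> k; rewrite /tau_star er e132 /= /reversal flipK.
rewrite !inE => /or4P[] /eqP e_eta; first exact: r231; last 2 first.
- exact: cluster_counts_231.
- have er : oneline (complement eta) = [:: 1; 3; 2] by rewrite oneline_complement e_eta.
  apply: (cluster_counts_transfer (h := complement)); last exact: r231.
  - exact: complementK.
  - exact: contains_complement.
  - exact: clusters_complement.
  by move=> k; rewrite /tau_star er e_eta /= /complement mul1g.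
have er : oneline (complement eta) = [:: 2; 3; 1] by rewrite oneline_complement e_eta.
apply: (cluster_counts_transfer (h := complement)); last exact: cluster_counts_231.
- exact: complementK.
- exact: contains_complement.
- exact: clusters_complement.
by move=> k; rewrite /tau_star er e_eta /= /complement flipK.
Qed.

End Combinatorics.

Import Order.TTheory GRing.Theory Num.Theory.
Import numFieldNormedType.Exports.
Local Open Scope classical_set_scope.
Local Open Scope ring_scope.

(** * The Wallis product *)

Section Wallis.
Context {R : realType}.
Implicit Types (n : nat) (x : R).

(** The primitive of sin^n that vanishes at 0, defined by the reduction formula.
    This gives the Wallis integrals as values of an elementary function, so that
    no integration theory is involved. *)
Fixpoint sin_primitive (n : nat) (x : R) : R :=
  match n with
  | 0%N => x
  | 1%N => 1 - cos x
  | (m.+1 as m1).+1 =>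
      m.+2%:R^-1 * (m1%:R * sin_primitive m x - cos x * sin x ^+ m1)
  end.

Lemma is_derive_sin_primitive n x :
  is_derive x 1 (sin_primitive n) (sin x ^+ n).
Proof.
elim/ltn_ind: n => -[|[|m]] IH.
- exact: is_derive_id.
- have -> : sin_primitive 1 = cst 1 - @cos R by [].
  by apply: is_derive_eq; rewrite sub0r opprK expr1.
have Fm := IH m (ltnW (ltnSn _)).
have -> : sin_primitive m.+2 =
    m.+2%:R^-1 \*: (m.+1%:R \*: sin_primitive m - @cos R * (@sin R ^+ m.+1)).
  by apply/funext => y; rewrite exprfctE.
apply: is_derive_eq.
rewrite exprfctE /GRing.scale /= !exprS.
have -> : m.+1%:R * sin x ^+ m - (cos x * (m.+1%:R * sin x ^+ m * cos x) +
    sin x * sin x ^+ m * - sin x) =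
    sin x ^+ m * (m.+1%:R * (1 - cos x ^+ 2) + sin x ^+ 2) by ring.
have -> : 1 - cos x ^+ 2 = sin x ^+ 2 by rewrite -(cos2Dsin2 x); ring.
have : m.+1%:R + 1 != 0 :> R by rewrite natr1 pnatr_eq0.
by rewrite -[m.+2%:R]natr1; move: (m.+1%:R : R) => M M1; field.
Qed.

Lemma sin_primitive0 n : sin_primitive n 0 = 0.
Proof.
elim/ltn_ind: n => -[|[|m]] IH //=; rewrite cos0 ?subrr //.
by rewrite sin0 IH // exprS mul0r !mulr0 subrr mulr0.
Qed.

Definition wallis (n : nat) : R := sin_primitive n (pi / 2).

Lemma wallisSS n : n.+2%:R * wallis n.+2 = n.+1%:R * wallis n.
Proof.
by rewrite /wallis /= cos_pihalf mul0r subr0 mulVKf // pnatr_eq0.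
Qed.

(** The difference of the primitives has derivative sin^n (1 - sin), which is
    nonnegative on [0, pi/2]. *)
Lemma wallisS_le n : wallis n.+1 <= wallis n.
Proof.
have pi2 : 0 <= pi / 2 :> R by rewrite divr_ge0 ?pi_ge0.
have der x : is_derive x 1 (sin_primitive n \- sin_primitive n.+1)
                (sin x ^+ n - sin x ^+ n.+1).
  by apply: is_deriveB; apply: is_derive_sin_primitive.
have [|c cI] := MVT_segment pi2 (fun x _ => der x).
  by apply: derivable_within_continuous => x _; apply: ex_derive.
move=> E; have {E} : wallis n - wallis n.+1 -
    (sin_primitive n 0 - sin_primitive n.+1 0) =
    (sin c ^+ n - sin c ^+ n.+1) * (pi / 2 - 0) := E.
rewrite !sin_primitive0 !subr0 => E.
rewrite -subr_ge0 E mulr_ge0 // exprSr -{1}[sin c ^+ n]mulr1 -mulrBr.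
rewrite mulr_ge0 ?subr_ge0 ?sin_le1 // exprn_ge0 //.
apply: sin_ge0_pi; move: cI; rewrite !in_itv /= => /andP[-> /le_trans]; apply.
by rewrite ler_pdivrMr // ler_peMr ?pi_ge0 ?ler1n.
Qed.

(** By the two-step recursion the product does not depend on n. *)
Lemma wallis_prod n : n.+1%:R * (wallis n * wallis n.+1) = pi / 2.
Proof.
elim: n => [|n IH].
  by rewrite mul1r /wallis /= cos_pihalf subr0 mulr1.
by rewrite [wallis n.+1 * _]mulrC mulrA wallisSS -mulrA IH.
Qed.

Definition central (n : nat) : R := 'C(2 * n, n)%:R / 4 ^+ n.

Lemma wallis_even n : wallis (2 * n) = pi / 2 * central n.
Proof.
elim: n => [|n IH]; first by rewrite /wallis /central /= bin0 expr0 divr1 mulr1.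
have := wallisSS (2 * n); rewrite IH.
have -> : (2 * n).+2 = (2 * n.+1)%N by lia.
have := congr1 (fun m => m%:R : R) (central_bin_rec n).
rewrite /central exprS !natrM -[n.+1%:R]natr1 -[(2 * n).+1%:R]natr1 natrM.
have : 4 ^+ n != 0 :> R by rewrite expf_neq0.
have : n%:R + 1 != 0 :> R by rewrite natr1 pnatr_eq0.
move: (4 ^+ n) (n%:R : R) => q N N0 q0 binS wS.
apply: (@mulfI _ (2 * (N + 1))); first by rewrite mulf_neq0.
rewrite {}wS [RHS](_ : _ = pi / (4 * q) * ((N + 1) * 'C(2 * n.+1, n.+1)%:R)).
  by rewrite binS; field.
by field.
Qed.

(** Since the Wallis integrals I decrease, (2n+1) I_(2n)^2 is at least the constant
    (2n+1) I_(2n) I_(2n+1) = pi/2, and 2n I_(2n)^2 is at most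
    2n I_(2n-1) I_(2n) = pi/2; here I_(2n) = (pi/2) [central n]. *)
Lemma central_bounds n : (0 < n)%N ->
  2 * n%:R / (2 * n%:R + 1) <= pi * n%:R * central n ^+ 2 <= 1.
Proof.
case: n => // n _; have pi0 := pi_gt0 R.
have c0 m : 0 < central m by rewrite divr_gt0 ?exprn_gt0 ?ltr0n ?bin_gt0 //; lia.
have Weven m : wallis (2 * m) = pi / 2 * central m := wallis_even m.
have W0 : 0 <= wallis (2 * n.+1) by rewrite Weven !mulr_ge0 // ltW.
have lo : pi / 2 <= (2 * n.+1).+1%:R * (wallis (2 * n.+1) * wallis (2 * n.+1)).
  by rewrite -(wallis_prod (2 * n.+1)) ler_pM2l ?ltr0n // ler_wpM2l // wallisS_le.
have up : (2 * n.+1)%:R * (wallis (2 * n.+1) * wallis (2 * n.+1)) <= pi / 2.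
  have -> : (2 * n.+1 = (2 * n).+2)%N by lia.
  rewrite -(wallis_prod (2 * n).+1) ler_pM2l ?ltr0n // ler_wpM2r ?wallisS_le //.
  by have -> : ((2 * n).+2 = 2 * n.+1)%N by lia.
rewrite Weven -[(2 * n.+1).+1%:R]natr1 natrM in lo.
rewrite Weven natrM in up.
set c := central n.+1 in lo up *; set N : R := n.+1%:R in lo up *.
have N0 : 0 < N by rewrite ltr0n.
have pi2 : 0 < pi / 2 :> R by rewrite divr_gt0.
have {}lo : 1 <= (2 * N + 1) * (pi / 2 * c ^+ 2).
  rewrite -(ler_pM2l pi2) mulr1; apply: le_trans lo _.
  by rewrite [leRHS](_ : _ = (2 * N + 1) * (pi / 2 * c * (pi / 2 * c))) //; field.
have {}up : pi * N * c ^+ 2 <= 1.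
  rewrite -(ler_pM2l pi2) mulr1; apply: le_trans up.
  by rewrite [leLHS](_ : _ = 2 * N * (pi / 2 * c * (pi / 2 * c))) //; field.
rewrite up andbT ler_pdivrMr; last by lra.
have -> : pi * N * c ^+ 2 * (2 * N + 1) = 2 * N * ((2 * N + 1) * (pi / 2 * c ^+ 2)).
  by field.
by rewrite -{1}[2 * N]mulr1 ler_pM2l // mulr_gt0.
Qed.

End Wallis.

(** * Exact expectations and the Catalan ratio *)

Section Limits.
Context {R : realType}.
Implicit Types (n k : nat).

Let A n : R := (num_av n)%:R.

Lemma num_av_gt0 n : (0 < num_av n)%N.
Proof.
by rewrite -(@ltn_pmul2l n.+1) // muln0 num_av_catalan bin_gt0; lia.
Qed.

Lemma catalanE n : catalan R n = A n.
Proof.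
by rewrite /catalan -num_av_catalan natrM mulKf // pnatr_eq0.
Qed.

Lemma num_avSE n : A n.+1 = (4 - 6 / (n%:R + 2)) * A n.
Proof.
have := congr1 (fun m => m%:R : R) (num_av_rec n).
rewrite !natrM natrD natrM -!/(A _) -[n.+2%:R]natr1 -natr1 => E.
have n2 : n%:R + 2 != 0 :> R by rewrite -natrD pnatr_eq0 addn2.
apply: (mulfI n2); rewrite (_ : n%:R + 2 = n%:R + 1 + 1) ?E; last by ring.
by field; rewrite -addrA.
Qed.

(** C_(m+1) / (4 C_m) = 1 - 3 / (2 (m+2)) lies between 1 - 3 / (2 (N+1)) and 1
    for m >= N; a product of j such factors is bounded below as in Bernoulli's
    inequality. *)
Lemma num_av_growth N j : (0 < N)%N ->
  (1 - j%:R * (3 / (2 * (N%:R + 1)))) * (4 ^+ j * A N) <= A (N + j) <= 4 ^+ j * A N.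
Proof.
move=> N0; set c : R := 3 / _.
have N1 : 1 <= N%:R :> R by rewrite ler1n.
have c1 : c <= 1 by rewrite /c ler_pdivrMr; lra.
have A0 n : 0 < A n by rewrite ltr0n num_av_gt0.
have c0 : 0 <= c by rewrite divr_ge0 //; lra.
elim: j => [|j /andP[lo up]].
  by rewrite addn0 mul0r subr0 expr0 !mul1r lexx.
have q0 : 0 < 4 ^+ j * A N by rewrite mulr_gt0 ?exprn_gt0.
rewrite addnS num_avSE natrD exprS.
set d : R := 6 / _.
have d0 : 0 <= d by rewrite divr_ge0.
have dc : d <= 4 * c.
  have -> : 4 * c = 6 / (N%:R + 1) by rewrite /c; field; lra.
  by rewrite ler_pM2l // lef_pV2 ?posrE; have : 0 <= j%:R :> R by []; lra.
have Aj := A0 (N + j)%N.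
apply/andP; split; last by nra.
rewrite -natr1; have j0 : 0 <= j%:R :> R by [].
apply: (@le_trans _ _ (4 * (1 - c) * A (N + j))); last by nra.
apply: (@le_trans _ _ (4 * (1 - c) * ((1 - j%:R * c) * (4 ^+ j * A N)))); last first.
  by rewrite ler_wpM2l //; lra.
rewrite -subr_ge0 [leRHS](_ : _ = 4 * (j%:R * c ^+ 2 * (4 ^+ j * A N))); last by ring.
by rewrite !mulr_ge0 ?sqr_ge0 // ltW.
Qed.

Definition catalan_ratio n k : R := 4 ^+ (k - 1) * A (n.+1 - k) / A n.

(** With N = n-k+1, [num_av_growth] bounds the inverse ratio between
    1 - (k-1) * 3 / (2 (N+1)) and 1, and the left end tends to 1 when k = o(n). *)
Lemma cvg_catalan_ratio (k : nat -> nat) :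
  (\forall n \near \oo, (0 < k n <= n)%N) ->
  (k n)%:R / n%:R @[n --> \oo] --> (0 : R) ->
  catalan_ratio n (k n) @[n --> \oo] --> (1 : R).
Proof.
move=> kn k0.
have A0 n : 0 < A n by rewrite ltr0n num_av_gt0.
have inv : (catalan_ratio n (k n))^-1 @[n --> \oo] --> (1 : R).
  have cvg1 : 1 - 3 / 2 * ((k n)%:R / n%:R / (1 - (k n)%:R / n%:R))
      @[n --> \oo] --> (1 : R).
    have E : 1 = 1 - 3 / 2 * (0 / (1 - 0)) :> R by rewrite mul0r mulr0 subr0.
    rewrite [X in _ --> X]E; apply: cvgB; first exact: cvg_cst.
    apply: cvgMr; apply: cvgM => //; apply: cvgV; first by rewrite subr0 oner_neq0.
    by apply: cvgB => //; exact: cvg_cst.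
  apply: (squeeze_cvgr _ cvg1 (cvg_cst (1 : R))).
  near=> n.
  have /andP[kn0 kn1] : (0 < k n <= n)%N by near: n.
  have k_lt : (k n)%:R / n%:R < 1 :> R by near: n; apply: (cvgr_lt 0).
  have n0 : (0 < n)%N by lia.
  have N0 : (0 < n.+1 - k n)%N by lia.
  have /andP[lo up] := @num_av_growth (n.+1 - k n) (k n - 1) N0.
  have E : (n.+1 - k n + (k n - 1) = n)%N by lia.
  rewrite E in lo up.
  have q0 : 0 < 4 ^+ (k n - 1) * A (n.+1 - k n) by rewrite mulr_gt0 ?exprn_gt0.
  rewrite /catalan_ratio invf_div ler_pdivrMr // mul1r up andbT ler_pdivlMr //.
  apply: le_trans lo; rewrite ler_pM2r // lerD2l lerN2.
  have n0' : 0 < n%:R :> R by rewrite ltr0n.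
  have k1 : 1 <= (k n)%:R :> R by rewrite ler1n.
  rewrite ltr_pdivrMr // mul1r in k_lt.
  rewrite (natrB _ kn0) (natrB _ (leqW kn1)) -[n.+1%:R]natr1.
  move: (n%:R : R) ((k n)%:R : R) n0' k1 k_lt {E} => x y x0 y1 yx.
  rewrite [leRHS](_ : _ = 3 / 2 * (y / (x - y))); last by field; lra.
  rewrite [leLHS](_ : _ = 3 / 2 * ((y - 1) / (x - y + 2))); last by field; lra.
  rewrite ler_pM2l // ler_pdivrMr; last by lra.
  by rewrite mulrAC ler_pdivlMr; [nra | lra].
have -> : (fun n => catalan_ratio n (k n)) = (fun n => (catalan_ratio n (k n))^-1^-1).
  by apply/funext => n; rewrite invrK.
by rewrite -[X in _ --> X]invr1; apply: cvgV => //; exact: oner_neq0.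
Unshelve. all: by end_near. Qed.

Lemma av_expectE (eta : 'S_3) n (X : 'S_n -> nat) :
  av_expect R eta X = (\sum_(s in av eta n) X s)%:R / #|av eta n|%:R.
Proof.
rewrite /av_expect natr_sum big_distrl /= [RHS]big_mkcond /=.
by apply: eq_bigr => s _; rewrite /unif_prob; case: ifP; rewrite ?mul0r // mulrC.
Qed.

Section Exact.
Variables (eta : 'S_3) (k n : nat).
Hypotheses (eta_av : cluster_counts eta) (kn : (0 < k <= n)%N).

Lemma expect_clusters_star : tau_star eta k \in av eta k ->
  av_expect R eta (fun s : 'S_n => clusters (tau_star eta k) s) =
  (n.+1 - k)%:R * catalan_ratio n k / 4 ^+ (k - 1).
Proof.
move=> tau_av; have [cardn sumn] := eta_av n.
rewrite av_expectE cardn sumn // eqxx natrM /catalan_ratio -/(A _).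
by field; rewrite pnatr_eq0 -lt0n num_av_gt0 expf_neq0.
Qed.

Lemma expect_clusters_nonstar (tau : 'S_k) : tau \in av eta k -> tau != tau_star eta k ->
  av_expect R eta (fun s : 'S_n => clusters tau s) =
  (n.+1 - k).+1%:R * catalan_ratio n k / (2 * 4 ^+ (k - 1)).
Proof.
move=> tau_av tau_neq; have [cardn sumn] := eta_av n.
rewrite av_expectE cardn sumn // (negPf tau_neq) /catalan_ratio -!/(A _).
have := total_rl_minima_eq (n.+1 - k).
have -> : (n.+1 - k == 0)%N = false by lia.
rewrite addn0 => /(congr1 (fun m => m%:R : R)); rewrite !natrM -/(A _) => E.
rewrite [RHS](_ : _ = (n.+1 - k).+1%:R * A (n.+1 - k) / A n / 2).
  by rewrite -E; field; rewrite pnatr_eq0 -lt0n num_av_gt0.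
by field; rewrite pnatr_eq0 -lt0n num_av_gt0 expf_neq0.
Qed.

(** There are C_k - 1 patterns other than [tau_star], all with the same
    expectation. *)
Lemma expect_clusters_all : tau_star eta k \in av eta k ->
  av_expect R eta (fun s : 'S_n => clusters_all eta k s) =
  (catalan R k - 1) * ((n.+1 - k).+1%:R * catalan_ratio n k / (2 * 4 ^+ (k - 1))) +
  (n.+1 - k)%:R * catalan_ratio n k / 4 ^+ (k - 1).
Proof.
move=> tau_av.
have -> : av_expect R eta (fun s : 'S_n => clusters_all eta k s) =
    \sum_(tau in av eta k) av_expect R eta (fun s : 'S_n => clusters tau s).
  rewrite av_expectE /clusters_all exchange_big natr_sum big_distrl /=.
  by apply: eq_bigr => tau _; rewrite av_expectE.
rewrite (bigD1 (tau_star eta k)) //= expect_clusters_star // addrC; congr (_ + _).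
rewrite (eq_bigr (fun=> (n.+1 - k).+1%:R * catalan_ratio n k / (2 * 4 ^+ (k - 1)))); last first.
  by move=> tau /andP[tav tn]; rewrite expect_clusters_nonstar.
rewrite sumr_const -[LHS]mulr_natl; congr (_ * _).
rewrite catalanE /A; have [<- _] := eta_av k.
rewrite (cardsD1 (tau_star eta k)) tau_av natrD addrC addKr.
by congr (_%:R); apply: eq_card => tau; rewrite in_setD1 andbC.
Qed.

End Exact.

End Limits.

(** * Limits *)

Section Final.
Context {R : realType}.
Implicit Types (n k : nat).

Lemma cvg_eq_near (f g : nat -> R) (l : R) :
  (\forall n \near \oo, f n = g n) -> g n @[n --> \oo] --> l ->
  f n @[n --> \oo] --> l.
Proof.
by move=> fg gl; apply: cvg_trans gl; apply: near_eq_cvg; near=> n; apply/esym; near: n.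
Unshelve. all: by end_near. Qed.

Lemma cvg_invn : n%:R^-1 @[n --> \oo] --> (0 : R).
Proof. by rewrite -cvg_shiftS; exact: cvg_harmonic. Qed.

Lemma catalan_scaledE k : (0 < k)%N ->
  Num.sqrt pi * k%:R `^ (3 / 2) * catalan R k / 4 ^+ k =
  Num.sqrt (pi * k%:R * central k ^+ 2) * (k%:R / (k%:R + 1)).
Proof.
move=> k0; have pi0 : 0 <= pi :> R := pi_ge0 R.
have k0' : 0 < k%:R :> R by rewrite ltr0n.
have -> : k%:R `^ (3 / 2) = k%:R * Num.sqrt k%:R :> R.
  rewrite (_ : 3 / 2 = 1 + 2^-1 :> R); last by field.
  by rewrite powRD ?powRr1 ?powR12_sqrt // (gt_eqF k0') implybT.
rewrite sqrtrM ?mulr_ge0 // sqrtrM // sqrtr_sqr ger0_norm; last first.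
  by rewrite divr_ge0.
rewrite /catalan /central -[k.+1%:R]natr1.
have : 4 ^+ k != 0 :> R by rewrite expf_neq0.
have : k%:R + 1 != 0 :> R by rewrite natr1 pnatr_eq0.
by move: (4 ^+ k) (k%:R : R) (Num.sqrt k%:R) => q x s x1 q0; field; rewrite q0 x1.
Qed.

(** [catalan_scaledE] writes the sequence as sqrt y * (k / (k+1)) with
    2k / (2k+1) <= y <= 1 by [central_bounds]; then also 2k / (2k+1) <= sqrt y <= 1. *)
Lemma catalan_scaled_cvg :
  Num.sqrt pi * k%:R `^ (3 / 2) * catalan R k / 4 ^+ k @[k --> \oo] --> (1 : R).
Proof.
have lo : 1 - 2 * k.+1%:R^-1 @[k --> \oo] --> (1 : R).
  have E : 1 = 1 - 2 * 0 :> R by rewrite mulr0 subr0.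
  rewrite [X in _ --> X]E; apply: cvgB; first exact: cvg_cst.
  by apply: cvgMr; exact: cvg_harmonic.
apply: (squeeze_cvgr _ lo (cvg_cst (1 : R))); near=> k.
have k0 : (0 < k)%N by near: k; exact: nbhs_infty_gt.
rewrite catalan_scaledE //; have := @central_bounds R k k0.
set y := pi * _ * _ => /andP[ylo yup].
have k1 : 1 <= k%:R :> R by rewrite ler1n.
have y0 : 0 <= y by apply: le_trans ylo; rewrite divr_ge0 //; lra.
have ss : Num.sqrt y ^+ 2 = y by rewrite sqr_sqrtr.
have s1 : Num.sqrt y <= 1 by rewrite -sqrtr1 ler_wsqrtr.
have s0 := sqrtr_ge0 y.
have ys : y <= Num.sqrt y by rewrite -{1}ss expr2 ler_piMl.
rewrite -[k.+1%:R]natr1.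
move: (k%:R : R) (Num.sqrt y) k1 ylo s1 s0 ys => x s x1 ylo s1 s0 ys.
have xd : 0 <= x / (x + 1) <= 1 by rewrite divr_ge0 /= ?ler_pdivrMr; lra.
apply/andP; split; last by case/andP: xd => *; nra.
apply: (@le_trans _ _ (2 * x / (2 * x + 1) * (x / (x + 1)))); last first.
  by case/andP: xd => xd _; apply: ler_wpM2r => //; apply: le_trans ylo ys.
have -> : 2 * x / (2 * x + 1) * (x / (x + 1)) =
    1 - (2 * x + 1)^-1 - 2 * x / (2 * x + 1) * (x + 1)^-1 by field; lra.
have b_le : (2 * x + 1)^-1 <= (x + 1)^-1 by rewrite lef_pV2 ?posrE; lra.
have c_le : 2 * x / (2 * x + 1) <= 1 by rewrite ler_pdivrMr; lra.
have a0 : 0 <= (x + 1)^-1 by rewrite invr_ge0; lra.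
by have := ler_wpM2r a0 c_le; lra.
Unshelve. all: by end_near. Qed.

Lemma leq_num_av k : (k <= num_av k)%N.
Proof.
elim: k => // k IH; have := num_av_rec k; have := num_av_gt0 k.
case: k IH => [|k] IH a0 E; last by nia.
exact: num_av_gt0.
Qed.

Lemma inv_catalan_cvg : (catalan R k)^-1 @[k --> \oo] --> (0 : R).
Proof.
apply: (squeeze_cvgr _ (cvg_cst (0 : R)) cvg_invn); near=> k.
have k0 : (0 < k)%N by near: k; exact: nbhs_infty_gt.
rewrite catalanE invr_ge0 ler0n /= lef_pV2 ?posrE ?ltr0n ?num_av_gt0 //.
by rewrite ler_nat leq_num_av.
Unshelve. all: by end_near. Qed.

Section Sequences.
Variable k : nat -> nat.
Hypotheses (kn : \forall n \near \oo, (0 < k n <= n)%N)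
           (k0 : (k n)%:R / n%:R @[n --> \oo] --> (0 : R)).

Lemma cvg_positions (j : nat) :
  (n.+1 - k n + j)%:R / n%:R @[n --> \oo] --> (1 : R).
Proof.
apply: (@cvg_eq_near _ (fun n => 1 - (k n)%:R / n%:R + j.+1%:R / n%:R)).
  near=> n; have /andP[kn0 kn1] : (0 < k n <= n)%N by near: n.
  have n0 : n%:R != 0 :> R by rewrite pnatr_eq0; lia.
  rewrite natrD (natrB _ (leqW kn1)) -[n.+1%:R]natr1 -[j.+1%:R]natr1.
  by field.
have E : 1 = 1 - 0 + j.+1%:R * 0 :> R by rewrite mulr0 subr0 addr0.
rewrite [X in _ --> X]E; apply: cvgD; first by apply: cvgB => //; exact: cvg_cst.
by apply: cvgMr; exact: cvg_invn.
Unshelve. all: by end_near. Qed.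

(** The normalized expectation for [tau_star] when j = 0, and for any other pattern
    when j = 1. *)
Lemma cvg_positions_ratio (j : nat) :
  (n.+1 - k n + j)%:R / n%:R * catalan_ratio n (k n) @[n --> \oo] --> (1 : R).
Proof.
by rewrite -[X in _ --> X]mulr1; apply: cvgM; [exact: cvg_positions|exact: cvg_catalan_ratio].
Qed.

Section Pattern.
Variable eta : 'S_3.
Hypotheses (eta_av : cluster_counts eta)
           (star_av : forall k, tau_star eta k \in av eta k).

Lemma asymp_clusters_star :
  asymp (fun n => av_expect R eta (fun s : 'S_n => clusters (tau_star eta (k n)) s))
        (fun n => n%:R / 4 ^+ (k n - 1)).
Proof.
apply: cvg_eq_near (cvg_positions_ratio 0); near=> n.
have kn' : (0 < k n <= n)%N by near: n.
rewrite expect_clusters_star // addn0.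
by field; rewrite expf_neq0 // pnatr_eq0; lia.
Unshelve. all: by end_near. Qed.

Lemma asymp_clusters_nonstar (tau : forall n, 'S_(k n)) :
  (\forall n \near \oo, tau n \in av eta (k n) /\ tau n <> tau_star eta (k n)) ->
  asymp (fun n => av_expect R eta (fun s : 'S_n => clusters (tau n) s))
        (fun n => n%:R / (2 * 4 ^+ (k n - 1))).
Proof.
move=> tauP; apply: cvg_eq_near (cvg_positions_ratio 1); near=> n.
have kn' : (0 < k n <= n)%N by near: n.
have [tau_av /eqP tau_neq] : tau n \in av eta (k n) /\ tau n <> tau_star eta (k n).
  by near: n.
rewrite expect_clusters_nonstar // addn1.
by field; rewrite expf_neq0 // pnatr_eq0; lia.
Unshelve. all: by end_near. Qed.

(** The quotient is s u + (s / C_k) (2 v - u), where u and v are the quotients that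
    tend to 1 for a pattern other than [tau_star] and for [tau_star], and
    s = sqrt pi k^(3/2) C_k / 4^k --> 1.  The second term vanishes in the limit
    because C_k --> oo. *)
Lemma asymp_clusters_all : k n @[n --> \oo] --> \oo ->
  asymp (fun n => av_expect R eta (fun s : 'S_n => clusters_all eta (k n) s))
        (fun n => 2 / Num.sqrt pi * (n%:R / (k n)%:R `^ (3 / 2))).
Proof.
move=> k_oo.
pose scaled m : R := Num.sqrt pi * m%:R `^ (3 / 2) * catalan R m / 4 ^+ m.
pose u n : R := (n.+1 - k n + 1)%:R / n%:R * catalan_ratio n (k n).
pose v n : R := (n.+1 - k n + 0)%:R / n%:R * catalan_ratio n (k n).
have scaled1 : scaled (k n) @[n --> \oo] --> (1 : R).
  exact: (cvg_comp _ _ k_oo catalan_scaled_cvg).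
have inv0 : (catalan R (k n))^-1 @[n --> \oo] --> (0 : R).
  exact: (cvg_comp _ _ k_oo inv_catalan_cvg).
apply: (@cvg_eq_near _ (fun n => scaled (k n) * u n +
    scaled (k n) * (catalan R (k n))^-1 * (2 * v n - u n))).
  near=> n; have kn' : (0 < k n <= n)%N by near: n.
  rewrite expect_clusters_all // /scaled /u /v addn0 addn1.
  have c0 : catalan R (k n) != 0 by rewrite catalanE pnatr_eq0 -lt0n num_av_gt0.
  have p0 : Num.sqrt pi != 0 :> R by rewrite gt_eqF // sqrtr_gt0 pi_gt0.
  have q0 : 4 ^+ (k n - 1) != 0 :> R by rewrite expf_neq0.
  have n0 : n%:R != 0 :> R by rewrite pnatr_eq0; lia.
  have K0 : (k n)%:R `^ (3 / 2) != 0 :> R.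
    by rewrite gt_eqF // powR_gt0 // ltr0n; lia.
  have -> : 4 ^+ k n = 4 * 4 ^+ (k n - 1) :> R.
    by rewrite -exprS; congr (_ ^+ _); lia.
  move: (_ `^ _) (4 ^+ _) (n%:R : R) (catalan _ _) (Num.sqrt _) c0 p0 q0 n0 K0.
  by move=> K q N C p c0 p0 q0 N0 K0; field; rewrite c0 p0 q0 N0 K0.
have E : 1 = 1 * 1 + 1 * 0 * (2 * 1 - 1) :> R by ring.
rewrite [X in _ --> X]E; have cu := cvg_positions_ratio 1.
have cv := cvg_positions_ratio 0.
by apply: cvgD; apply: cvgM => //; [exact: cvgM | apply: cvgB => //; exact: cvgMr].
Unshelve. all: by end_near. Qed.

End Pattern.
End Sequences.

Lemma fixed_size_near k : (0 < k)%N ->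
  (\forall n \near \oo, (0 < k <= n)%N) /\
  k%:R / n%:R @[n --> \oo] --> (0 : R).
Proof.
move=> k0; split; first by near=> n; rewrite k0 /=; near: n; exact: nbhs_infty_ge.
by rewrite -[X in _ --> X](mulr0 k%:R); apply: cvgMr; exact: cvg_invn.
Unshelve. all: by end_near. Qed.

Lemma fixed_of_asymp (a : nat -> R) (c : R) : c != 0 ->
  asymp a (fun n => n%:R / c) -> n%:R^-1 * a n @[n --> \oo] --> 1 / c.
Proof.
move=> c0 ac; apply: (@cvg_eq_near _ (fun n => a n / (n%:R / c) * c^-1)).
  near=> n; have n0 : n%:R != 0 :> R.
    by rewrite pnatr_eq0 -lt0n; near: n; exact: nbhs_infty_gt.
  by field; rewrite c0 n0.
by apply: cvgMl.
Unshelve. all: by end_near. Qed.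

Lemma fixed_clusters_all (eta : 'S_3) k : (0 < k)%N ->
  cluster_counts eta -> tau_star eta k \in av eta k ->
  n%:R^-1 * av_expect R eta (fun s : 'S_n => clusters_all eta k s)
    @[n --> \oo] --> ((catalan R k + 1) / (2 * 4 ^+ (k - 1)) : R).
Proof.
move=> k_gt0 eta_av star_av; have [kn k0] := fixed_size_near k_gt0.
set c := catalan R k; set q : R := 4 ^+ (k - 1).
pose u n : R := (n.+1 - k + 1)%:R / n%:R * catalan_ratio n k.
pose v n : R := (n.+1 - k + 0)%:R / n%:R * catalan_ratio n k.
have q0 : q != 0 by rewrite expf_neq0.
apply: (@cvg_eq_near _ (fun n => (c - 1) / (2 * q) * u n + q^-1 * v n)).
  near=> n; have kn' : (0 < k <= n)%N by near: n.
  have n0 : n%:R != 0 :> R by rewrite pnatr_eq0; lia.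
  rewrite expect_clusters_all // /u /v addn0 addn1 -/c -/q.
  by field; rewrite q0 n0.
have -> : (c + 1) / (2 * q) = (c - 1) / (2 * q) * 1 + q^-1 * 1 by field.
have cu := cvg_positions_ratio kn k0 1; have cv := cvg_positions_ratio kn k0 0.
by apply: cvgD; apply: cvgMr.
Unshelve. all: by end_near. Qed.

Lemma cvg_sublinear (k : nat -> nat) : sublinear R k ->
  (k n)%:R / n%:R @[n --> \oo] --> (0 : R).
Proof.
move=> /eqoP ko; apply/cvgrPdist_le => e e0; near=> n.
have n0 : (0 < n)%N by near: n; exact: nbhs_infty_gt.
rewrite sub0r normrN ger0_norm ?divr_ge0 // ler_pdivrMr ?ltr0n //.
have : `|(k n)%:R : R| <= e * `|n%:R : R| by near: n; exact: ko.
by rewrite !ger0_norm.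
Unshelve. all: by end_near. Qed.

Lemma cluster_sizes_near (k : nat -> nat) : cluster_sizes k ->
  \forall n \near \oo, (0 < k n <= n)%N.
Proof.
move=> kP; near=> n; have n2 : (2 <= n)%N by near: n; exact: nbhs_infty_ge.
by have := kP n n2; lia.
Unshelve. all: by end_near. Qed.

End Final.

Theorem corollary1 (R : realType) (eta : 'S_3)
  (eta_in : oneline eta \in
     [:: [:: 1%N; 3%N; 2%N]; [:: 2%N; 1%N; 3%N];
         [:: 2%N; 3%N; 1%N]; [:: 3%N; 1%N; 2%N]]) :
  (* (i) *)
  ((forall (k : nat) (tau : 'S_k), (2 <= k)%N ->
      tau \in av eta k -> tau <> tau_star eta k ->
      n%:R^-1 * av_expect R eta (fun sigma : 'S_n => clusters tau sigma)
        @[n --> \oo] --> (1 / (2 * 4 ^+ (k - 1)) : R))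
   /\
   (forall (k : nat -> nat) (tau : forall n : nat, 'S_(k n)),
      cluster_sizes k -> sublinear R k ->
      (forall n : nat, (2 <= n)%N ->
         tau n \in av eta (k n) /\ tau n <> tau_star eta (k n)) ->
      asymp
        (fun n => av_expect R eta (fun sigma : 'S_n => clusters (tau n) sigma))
        (fun n => n%:R / (2 * 4 ^+ (k n - 1)))))
  /\
  (* (ii) *)
  ((forall k : nat, (2 <= k)%N ->
      n%:R^-1 * av_expect R eta
                  (fun sigma : 'S_n => clusters (tau_star eta k) sigma)
        @[n --> \oo] --> (1 / 4 ^+ (k - 1) : R))
   /\
   (forall k : nat -> nat,
      cluster_sizes k -> sublinear R k ->
      asymp
        (fun n => av_expect R eta
                    (fun sigma : 'S_n => clusters (tau_star eta (k n)) sigma))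
        (fun n => n%:R / 4 ^+ (k n - 1))))
  /\
  (* (iii) *)
  ((forall k : nat, (2 <= k)%N ->
      n%:R^-1 * av_expect R eta (fun sigma : 'S_n => clusters_all eta k sigma)
        @[n --> \oo] --> ((catalan R k + 1) / (2 * 4 ^+ (k - 1)) : R))
   /\
   (forall k : nat -> nat,
      cluster_sizes k -> k n @[n --> \oo] --> \oo -> sublinear R k ->
      asymp
        (fun n => av_expect R eta
                    (fun sigma : 'S_n => clusters_all eta (k n) sigma))
        (fun n => 2 / Num.sqrt pi * (n%:R / (k n)%:R `^ (3 / 2))))).
Proof.
have eta_av := cluster_counts_all eta_in.
have star_av k := tau_star_av k eta_in.
have pow4 k : 4 ^+ k != 0 :> R by rewrite expf_neq0.
split; [split|split; split].
- move=> k tau /ltnW/(@fixed_size_near R)[kn k0] tau_av tau_neq.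
  apply: fixed_of_asymp; first by rewrite mulf_neq0.
  by apply: (@asymp_clusters_nonstar _ (fun=> k)) => //; apply: nearW => n.
- move=> k tau /cluster_sizes_near kn /cvg_sublinear k0 tauP.
  apply: asymp_clusters_nonstar => //; near=> n; apply: tauP.
  by near: n; exact: nbhs_infty_ge.
- move=> k /ltnW/(@fixed_size_near R)[kn k0]; apply: fixed_of_asymp => //.
  exact: (@asymp_clusters_star _ (fun=> k)).
- move=> k /cluster_sizes_near kn /cvg_sublinear k0.
  exact: asymp_clusters_star.
- by move=> k /ltnW k0; exact: fixed_clusters_all.
move=> k /cluster_sizes_near kn k_oo /cvg_sublinear k0.
exact: asymp_clusters_all.
Unshelve. all: by end_near. Qed.
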